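(* $|\mathsf{PTAB}(\mathsf{S4BP}^{2,\omega}_{2,2})|=\aleph_0$.
   Context: Tense formulas use $\Box$ and a past possibility operator written here $\mathsf{P}$; $\mathsf{S4}_t=\mathsf{K}_t\oplus\{\Box p\to p,\Box p\to\Box\Box p\}$. $\mathsf{S4BP}^{2,\omega}_{2,2}$ is $\mathsf{S4}_t$ extended by axioms bounding depth by 2, forth-width by 2 and back-width by 2 (with $\mathbf{bd}_1=\Diamond\Box p_0\to p_0$, $\mathbf{bd}_2=\Diamond(\Box p_1\wedge\neg\mathbf{bd}_1)\to p_1$, $\mathbf{bw}^+_2=\bigwedge_{i\leq2}\Diamond p_i\to\bigvee_{i\neq j\leq2}\Diamond(p_i\wedge(p_j\vee\Diamond p_j))$, and $\mathbf{bw}^-_2$ the same with $\mathsf{P}$ in place of $\Diamond$); no bound on z-degree. $\mathsf{PTAB}(L)$ is the set of pretabular logics (non-tabular, every consistent proper extension tabular) extending $L$. *)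

(* Defs.v *)
From mathcomp Require Import all_boot.
From mathcomp Require Import boolp classical_sets functions cardinality.

Set Implicit Arguments.
Unset Strict Implicit.
Unset Printing Implicit Defensive.

Local Open Scope classical_set_scope.

Inductive form : Type :=
| Var of nat
| Bot
| Imp of form & form
| Box of form
| Past of form. (* past possibility *)

Definition Neg (f : form) : form := Imp f Bot.
Definition Top : form := Neg Bot.
Definition Or (f g : form) : form := Imp (Neg f) g.
Definition And (f g : form) : form := Neg (Imp f (Neg g)).
Definition Dia (f : form) : form := Neg (Box (Neg f)).
Definition PBox (f : form) : form := Neg (Past (Neg f)).

Fixpoint subst (s : nat -> form) (f : form) : form :=
  match f with
  | Var n => s n
  | Bot => Bot
  | Imp g h => Imp (subst s g) (subst s h)
  | Box g => Box (subst s g)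
  | Past g => Past (subst s g)
  end.

(* Boolean evaluation in which variables and modal formulas are the atoms, so
   that [tautology] covers all instances of classical tautologies. *)
Fixpoint beval (v : form -> bool) (f : form) : bool :=
  match f with
  | Bot => false
  | Imp g h => beval v g ==> beval v h
  | _ => v f
  end.

Definition tautology (f : form) : Prop := forall v, beval v f.

Record tense_logic (L : set form) : Prop := TenseLogic {
  tl_taut : forall f, tautology f -> L f;
  tl_boxK : forall f g, L (Imp (Box (Imp f g)) (Imp (Box f) (Box g)));
  tl_pboxK : forall f g, L (Imp (PBox (Imp f g)) (Imp (PBox f) (PBox g)));
  tl_conv_future : forall f, L (Imp f (Box (Past f)));
  tl_conv_past : forall f, L (Imp f (PBox (Dia f)));
  tl_mp : forall f g, L (Imp f g) -> L f -> L g;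
  tl_subst : forall s f, L f -> L (subst s f);
  tl_box_nec : forall f, L f -> L (Box f);
  tl_pbox_nec : forall f, L f -> L (PBox f)
}.

Definition oplus (L S : set form) : set form :=
  [set f | forall L', tense_logic L' -> L `<=` L' -> S `<=` L' -> L' f].

Definition Kt : set form :=
  [set f | forall L', tense_logic L' -> L' f].

Definition axT : form := Imp (Box (Var 0)) (Var 0).
Definition ax4 : form := Imp (Box (Var 0)) (Box (Box (Var 0))).

Definition S4t : set form := oplus Kt [set axT; ax4].

Definition bd1 : form := Imp (Dia (Box (Var 0))) (Var 0).
Definition bd2 : form := Imp (Dia (And (Box (Var 1)) (Neg bd1))) (Var 1).

(* The width axiom for the possibility operator [d]; indices range over
   0, ..., n inclusive. *)
Definition bw (d : form -> form) (n : nat) : form :=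
  Imp (\big[And/Top]_(i < n.+1) d (Var i))
      (\big[Or/Bot]_(i < n.+1) \big[Or/Bot]_(j < n.+1 | i != j)
         d (And (Var i) (Or (Var j) (d (Var j))))).

Definition bw_forth : nat -> form := bw Dia.
Definition bw_back : nat -> form := bw Past.

(* S4BP with depth, forth-width and back-width at most 2, and no bound on
   the z-degree. *)
Definition S4BP_2omega_22 : set form :=
  oplus S4t [set bd2; bw_forth 2; bw_back 2].

Fixpoint sat (T : Type) (R : T -> T -> Prop) (V : nat -> set T) (x : T)
    (f : form) : Prop :=
  match f with
  | Var n => V n x
  | Bot => False
  | Imp g h => sat R V x g -> sat R V x h
  | Box g => forall y, R x y -> sat R V y g
  | Past g => exists2 y, R y x & sat R V y g
  end.

Definition Log (T : Type) (R : T -> T -> Prop) : set form :=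
  [set f | forall V x, sat R V x f].

Definition consistent (L : set form) : Prop := ~ L Bot.

(* The frame may be empty: its logic is the inconsistent logic, which therefore
   counts as tabular and is not pretabular. *)
Definition tabular (L : set form) : Prop :=
  exists (T : finType) (R : T -> T -> Prop), L = Log R.

Definition pretabular (L : set form) : Prop :=
  [/\ tense_logic L, ~ tabular L &
      forall L', tense_logic L' -> L `<` L' -> consistent L' -> tabular L'].

Definition PTAB (L : set form) : set (set form) :=
  [set L' | pretabular L' /\ L `<=` L'].

(* Main.v *)
From Stdlib Require Import ZArith.
Require Import Defs.
From HB Require Import structures.
From mathcomp Require Import all_boot.
From mathcomp Require Import boolp classical_sets functions cardinality.
From mathcomp Require Import zify.

Set Implicit Arguments.
Unset Strict Implicit.
Unset Printing Implicit Defensive.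

Local Open Scope classical_set_scope.
Local Open Scope card_scope.

(** Work in refined models: the canonical model shows that a logic extending
S4BP is determined by models in which distinct points, and pairs not in the
relation, are separated by formulas. The axioms force such a model to have depth
at most two and at most two clusters strictly above or below each point, so a
connected component is a zigzag path or cycle of clusters. A logic is tabular iff
some formula [Tab n] bounds the size of the components.

Upper bound: it suffices to put every non-tabular logic below one of countably
many consistent non-tabular logics. If arbitrarily long geodesics occur, the
inner part of a geodesic has no other neighbours, its clusters are definable, and
refutations on the infinite zigzag of single points can be copied to it.
Otherwise the number of clusters per component is bounded, so clusters are
unboundedly large, and by pigeonhole a single finite skeleton with a single
marked vertex carries them; merging the points of the other clusters gives
the logic of that skeleton with the marked vertex blown up.

Lower bound: blow up one end of a path with [k.+3] vertices and take a pretabular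
logic above its logic. That logic says that any nontrivial cluster has a point at
zigzag distance [k.+2], so the pretabular logic bounds the zigzag diameter
by [k.+2] but not by [k.+1]; hence these logics are pairwise distinct. *)

(** Zorn is applied to the sets [X] for which [X0] together with [X] satisfies [Q]. This keeps the
    base point below the maximal set, and [Q X0] takes care of the empty chain, which [Qchain]
    excludes. *)
Lemma zorn_above (T : Type) (Q : set (set T)) (X0 : set T) : Q X0 ->
  (forall F : set (set T), F !=set0 -> F `<=` Q -> total_on F subset ->
     Q (\bigcup_(X in F) X)) ->
  exists A, [/\ Q A, X0 `<=` A & forall B, Q B -> A `<=` B -> B `<=` A].
Proof.
move=> Q0 Qchain.
have [|A [QA Amax]] := @Zorn_bigcup T [set X | Q (X0 `|` X)].
  move=> F FQ Ftot /=; case: (pselect (F !=set0)) => [F0|F0]; last first.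
    suff -> : \bigcup_(X in F) X = set0 by rewrite setU0.
    by apply/seteqP; split=> // x [X FX _]; case: F0; exists X.
  suff -> : X0 `|` \bigcup_(X in F) X =
      \bigcup_(Y in [set X0 `|` X | X in F]) Y.
    apply: Qchain.
    - by case: F0 => X FX; exists (X0 `|` X), X.
    - by move=> _ [X FX <-]; exact: FQ.
    - move=> _ _ [X FX <-] [Y FY <-]; case: (Ftot X Y FX FY) => XY.
        by left; exact: setUS.
      by right; exact: setUS.
  apply/seteqP; split=> x.
    case=> [x0|[X FX Xx]].
      by case: F0 => X FX; exists (X0 `|` X); [exact: imageP | left].
    by exists (X0 `|` X); [exact: imageP | right].
  by case=> _ [X FX <-] [x0|Xx]; [left | right; exists X].
exists (X0 `|` A); split=> [//|x x0|B QB AB]; first by left.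
apply: contrapT => nBA; apply: (Amax B).
  split=> [x Ax|BA]; first by apply: AB; right.
  by apply: nBA => x /BA; right.
by rewrite /= (_ : X0 `|` B = B) //; apply/setUidPr => x x0; apply: AB; left.
Qed.

(** * Semantics *)

Section Semantics.
Variables (T : Type) (R : T -> T -> Prop) (V : nat -> set T).

Lemma sat_neg x f : sat R V x (Neg f) <-> ~ sat R V x f.
Proof. by []. Qed.

Lemma sat_imp x f g : sat R V x (Imp f g) <-> (sat R V x f -> sat R V x g).
Proof. by []. Qed.

Lemma sat_or x f g : sat R V x (Or f g) <-> sat R V x f \/ sat R V x g.
Proof.
rewrite /=; split; last by case.
by case: (pselect (sat R V x f)) => [h _|nf /(_ nf) h]; [left | right].
Qed.

Lemma sat_and x f g : sat R V x (And f g) <-> sat R V x f /\ sat R V x g.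
Proof.
rewrite /=; split; last by move=> [a b] /(_ a b).
by move=> h; split; apply: contrapT => n; apply: h => // ?.
Qed.

Lemma sat_dia x f : sat R V x (Dia f) <-> exists2 y, R x y & sat R V y f.
Proof.
rewrite /=; split; last by move=> [y xy fy] /(_ y xy).
move=> h; apply: contrapT => n; apply: h => y xy fy.
by apply: n; exists y.
Qed.

Lemma sat_past x f : sat R V x (Past f) <-> exists2 y, R y x & sat R V y f.
Proof. by []. Qed.

Lemma sat_bigand x (I : eqType) (r : seq I) (P : pred I) F :
  sat R V x (\big[And/Top]_(i <- r | P i) F i) <->
  (forall i, i \in r -> P i -> sat R V x (F i)).
Proof.
elim: r => [|i r IH]; first by rewrite big_nil /=; split.
rewrite big_cons; split.
  move=> h j; rewrite inE => /orP[/eqP ->|jr] Pj.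
    by move: h; rewrite Pj => /sat_and[].
  move: h; case: ifP => _ h; apply: IH.1 => //.
  by case/sat_and: h.
move=> h; have hr : sat R V x (\big[And/Top]_(j <- r | P j) F j).
  by apply/IH => j jr; apply: h; rewrite inE jr orbT.
by case: ifP => // Pi; apply/sat_and; split=> //; apply: h; rewrite ?mem_head.
Qed.

Lemma sat_bigor x (I : eqType) (r : seq I) (P : pred I) F :
  sat R V x (\big[Or/Bot]_(i <- r | P i) F i) <->
  (exists i, [/\ i \in r, P i & sat R V x (F i)]).
Proof.
elim: r => [|i r IH]; first by rewrite big_nil /=; split=> // -[?[]].
rewrite big_cons; split.
  case: ifP => Pi => [/sat_or[h|]|]; first by exists i; rewrite mem_head.
    by move=> /IH[j [jr Pj h]]; exists j; rewrite inE jr orbT.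
  by move=> /IH[j [jr Pj h]]; exists j; rewrite inE jr orbT.
case=> j [+ Pj h]; rewrite inE => /orP[/eqP <-|jr].
  by rewrite Pj; apply/sat_or; left.
have hr : sat R V x (\big[Or/Bot]_(j <- r | P j) F j) by apply/IH; exists j.
by case: ifP => // _; apply/sat_or; right.
Qed.

Lemma sat_bigand_ord x n (P : pred 'I_n) F :
  sat R V x (\big[And/Top]_(i < n | P i) F i) <->
  (forall i, P i -> sat R V x (F i)).
Proof.
rewrite sat_bigand; split=> h i; last by move=> _; exact: h.
by apply: h; rewrite mem_index_enum.
Qed.

Lemma sat_bigor_ord x (I : finType) (P : pred I) F :
  sat R V x (\big[Or/Bot]_(i | P i) F i) <->
  (exists2 i, P i & sat R V x (F i)).
Proof.
rewrite sat_bigor; split=> [[i [_ Pi h]]|[i Pi h]]; by exists i.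
Qed.

End Semantics.

Arguments sat_neg {T R V x f}.
Arguments sat_imp {T R V x f g}.
Arguments sat_past {T R V x f}.
Arguments sat_or {T R V x f g}.
Arguments sat_and {T R V x f g}.
Arguments sat_dia {T R V x f}.
Arguments sat_bigand_ord {T R V x n P F}.
Arguments sat_bigor_ord {T R V x I P F}.

Lemma sat_subst (T : Type) (R : T -> T -> Prop) (V : nat -> set T) s f x :
  sat R V x (subst s f) <-> sat R (fun n y => sat R V y (s n)) x f.
Proof.
elim: f x => [n||f IHf g IHg|f IH|f IH] x //=.
- by rewrite IHf IHg.
- by split=> h y xy; apply/IH; apply: h.
- by split=> -[y xy /IH h]; exists y.
Qed.

Fixpoint mdepth (f : form) : nat :=
  match f with
  | Imp g h => maxn (mdepth g) (mdepth h)
  | Box g | Past g => (mdepth g).+1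
  | _ => 0
  end.

(** The bisimulation is graded by the modal depth still to be spent, so that it may run out near the
    ends of a finite path. Ungraded bisimulations are the case where [B] ignores its index. *)
Lemma bisim_sat (T W : Type) (R : T -> T -> Prop) (Q : W -> W -> Prop)
    (V : nat -> set T) (U : nat -> set W) (B : nat -> T -> W -> Prop) :
  (forall d x w p, B d x w -> (V p x <-> U p w)) ->
  (forall d x w, B d.+1 x w ->
     [/\ forall y, R x y -> exists2 u, Q w u & B d y u,
         forall u, Q w u -> exists2 y, R x y & B d y u,
         forall y, R y x -> exists2 u, Q u w & B d y u &
         forall u, Q u w -> exists2 y, R y x & B d y u]) ->
  forall f d x w, mdepth f <= d -> B d x w -> (sat R V x f <-> sat Q U w f).
Proof.
move=> Bat Bst; elim=> [n||f IHf g IHg|f IH|f IH] d x w //=.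
- by move=> _ Bxw; exact: Bat Bxw.
- by rewrite geq_max => /andP[df dg] Bxw; rewrite (IHf d x w) // (IHg d x w).
- case: d => // d dd /Bst[B1 B2 _ _]; split=> h.
    move=> u /B2[y xy Byu]; apply/(IH d y u) => //; exact: h.
  move=> y /B1[u xy Byu]; apply/(IH d y u) => //; exact: h.
- case: d => // d dd /Bst[_ _ B3 B4]; split=> -[y].
    by move=> /B3[u xy Byu] h; exists u => //; apply/(IH d y u).
  by move=> /B4[u xy Byu] h; exists u => //; apply/(IH d u y).
Qed.

Lemma tense_logic_Log (T : Type) (R : T -> T -> Prop) : tense_logic (Log R).
Proof.
split.
- move=> f ft V x; have := ft (fun g => `[< sat R V x g >]).
  suff -> : forall g, beval (fun h => `[< sat R V x h >]) g
      = `[< sat R V x g >] by move/asboolP.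
  elim=> [n||g IHg h IHh|g IH|g IH] //=; first by rewrite asboolF.
  by rewrite IHg IHh asbool_imply.
- by move=> f g V x /= fg f' y xy; apply: fg => //; apply: f'.
- move=> f g V x /= fg f' [y yx ng]; apply: fg; exists y => // ffg.
  by apply: f'; exists y => // /ffg.
- by move=> f V x /= fx y xy; exists x.
- by move=> f V x /= fx [y yx]; apply => /(_ x yx).
- by move=> f g fg f' V x; apply: (fg V x); apply: f'.
- by move=> s f ff V x; apply/sat_subst; apply: ff.
- by move=> f ff V x y _; apply: ff.
- by move=> f ff V x /= -[y _]; apply; apply: ff.
Qed.

Lemma tense_logic_bigcap (I : Type) (D : set I) (L : I -> set form) :
  (forall i, D i -> tense_logic (L i)) -> tense_logic (\bigcap_(i in D) L i).
Proof.
move=> Lt; split.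
- by move=> f ft i Di; exact: tl_taut (Lt i Di) _ ft.
- by move=> f g i Di; exact: tl_boxK (Lt i Di) _ _.
- by move=> f g i Di; exact: tl_pboxK (Lt i Di) _ _.
- by move=> f i Di; exact: tl_conv_future (Lt i Di) _.
- by move=> f i Di; exact: tl_conv_past (Lt i Di) _.
- by move=> f g fg f' i Di; apply: tl_mp (Lt i Di) _ _ (fg i Di) (f' i Di).
- by move=> s f ff i Di; apply: tl_subst (Lt i Di) _ _ (ff i Di).
- by move=> f ff i Di; apply: tl_box_nec (Lt i Di) _ (ff i Di).
- by move=> f ff i Di; apply: tl_pbox_nec (Lt i Di) _ (ff i Di).
Qed.

Lemma tense_logic_bigcup (F : set (set form)) : F !=set0 ->
  F `<=` tense_logic -> total_on F subset ->
  tense_logic (\bigcup_(X in F) X).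
Proof.
move=> [L0 FL0] Ft Ftot; have tL0 := Ft _ FL0; split.
- by move=> f ft; exists L0 => //; exact: tl_taut.
- by move=> f g; exists L0 => //; exact: tl_boxK.
- by move=> f g; exists L0 => //; exact: tl_pboxK.
- by move=> f; exists L0 => //; exact: tl_conv_future.
- by move=> f; exists L0 => //; exact: tl_conv_past.
- move=> f g [X FX Xfg] [Y FY Yf]; case: (Ftot X Y FX FY) => XY.
    by exists Y => //; apply: tl_mp (Ft _ FY) _ _ (XY _ Xfg) Yf.
  by exists X => //; apply: tl_mp (Ft _ FX) _ _ Xfg (XY _ Yf).
- by move=> s f [X FX Xf]; exists X => //; apply: tl_subst (Ft _ FX) _ _ Xf.
- by move=> f [X FX Xf]; exists X => //; apply: tl_box_nec (Ft _ FX) _ Xf.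
- by move=> f [X FX Xf]; exists X => //; apply: tl_pbox_nec (Ft _ FX) _ Xf.
Qed.

(** * Canonical models *)

Ltac taut_tac :=
  let v := fresh "v" in
  move=> v /=;
  repeat match goal with
  | |- context [beval v ?f] => case: (beval v f)
  | |- context [v ?f] => case: (v f)
  end; by [].

Lemma subst_bigand s (I : Type) (r : seq I) (P : pred I) F :
  subst s (\big[And/Top]_(i <- r | P i) F i)
  = \big[And/Top]_(i <- r | P i) subst s (F i).
Proof. exact: (big_morph (subst s)). Qed.

Lemma subst_bigor s (I : Type) (r : seq I) (P : pred I) F :
  subst s (\big[Or/Bot]_(i <- r | P i) F i)
  = \big[Or/Bot]_(i <- r | P i) subst s (F i).
Proof. exact: (big_morph (subst s)). Qed.

Section Canonical.
Variable L : set form.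
Hypothesis tL : tense_logic L.

Definition theory (G : set form) : Prop :=
  L `<=` G /\ forall f g, G (Imp f g) -> G f -> G g.

Definition mcs (G : set form) : Prop :=
  [/\ theory G, ~ G Bot & forall f, G f \/ G (Neg f)].

Lemma theory_taut G f : theory G -> tautology f -> G f.
Proof. by move=> [LG _] ft; apply/LG/(tl_taut tL). Qed.

Lemma lindenbaum G0 : theory G0 -> ~ G0 Bot -> exists2 G, mcs G & G0 `<=` G.
Proof.
move=> tG0 nB.
have [||G [[tG GB] G0G Gmax]] :=
    @zorn_above _ [set G | theory G /\ ~ G Bot] G0; first by [].
  move=> F [X0 FX0] FQ Ftot; split; last by move=> [X /FQ[]].
  split=> [f Lf|f g [X FX Xfg] [Y FY Yf]].
    by exists X0 => //; have [[LX _] _] := FQ _ FX0; exact: LX.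
  have [[_ mpX] _] := FQ _ FX; have [[_ mpY] _] := FQ _ FY.
  case: (Ftot X Y FX FY) => XY.
    by exists Y => //; apply: mpY Yf; exact: XY.
  by exists X => //; apply: mpX Xfg _; exact: XY.
exists G => //; split=> // f.
case: (pselect (G (Neg f))) => [|nGf]; [by right | left].
have [_ mp] := tG.
(* This is the theory generated by [G] and [f]. It is consistent because [Neg f] is not in [G], so
   maximality puts [f] in [G]. *)
apply: (Gmax [set g | G (Imp f g)]).
- split; last exact: nGf.
  split=> [g Lg|g h fgh fg] /=.
    by apply: (mp g); [apply: theory_taut => //; taut_tac |
       exact: tG.1].
  apply: (mp (Imp f g)) => //; apply: (mp _ _ _ fgh).
  by apply: theory_taut => //; taut_tac.
- move=> g Gg /=; apply: (mp g) => //.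
  by apply: theory_taut => //; taut_tac.
- by rewrite /=; apply: theory_taut => //; taut_tac.
Qed.

Section Mcs.
Variable G : set form.
Hypothesis mG : mcs G.

Lemma mcs_mp f g : G (Imp f g) -> G f -> G g.
Proof. by case: mG => -[_ mp] _ _; exact: mp. Qed.

Lemma mcs_logic f : L f -> G f.
Proof. by case: mG => -[LG _] _ _; exact: LG. Qed.

Lemma mcs_neg f : G (Neg f) <-> ~ G f.
Proof.
case: mG => -[_ mp] nB tot; split=> [nf Gf|nf]; first exact: nB (mp _ _ nf Gf).
by case: (tot f).
Qed.

Lemma mcs_imp f g : G (Imp f g) <-> (G f -> G g).
Proof.
split=> [fg|fg]; first exact: mcs_mp.
have tG : theory G by case: mG.
case: (pselect (G f)) => [/fg Gg|/mcs_neg nf].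
  apply: (mcs_mp _ Gg).
  by apply: theory_taut => //; taut_tac.
apply: (mcs_mp _ nf).
by apply: theory_taut => //; taut_tac.
Qed.

Lemma mcs_and f g : G (And f g) <-> G f /\ G g.
Proof.
rewrite mcs_neg mcs_imp mcs_neg; split; last by move=> [a b] /(_ a b).
by move=> h; split; apply: contrapT => n; apply: h => // ?.
Qed.

Lemma mcs_or f g : G (Or f g) <-> G f \/ G g.
Proof.
rewrite mcs_imp mcs_neg; split; last by case.
by case: (pselect (G f)) => [h _|nf /(_ nf) h]; [left | right].
Qed.

Lemma mcs_bigand (I : finType) (P : pred I) F :
  G (\big[And/Top]_(i | P i) F i) <-> (forall i, P i -> G (F i)).
Proof.
have GT : G Top by apply/mcs_neg; case: mG.
rewrite -big_filter; split.
  move=> h i Pi; have : i \in [seq i <- index_enum I | P i].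
    by rewrite mem_filter Pi mem_index_enum.
  elim: [seq i <- _ | _] h => // j s IH.
  by rewrite big_cons inE => /mcs_and[Gj /IH h] /orP[/eqP ->|].
move=> h; have : forall i, i \in [seq i <- index_enum I | P i] -> G (F i).
  by move=> i; rewrite mem_filter => /andP[/h].
elim: [seq i <- _ | _] => [|j s IH] hs; first by rewrite big_nil.
rewrite big_cons; apply/mcs_and; split; first exact/hs/mem_head.
by apply: IH => i si; apply: hs; rewrite inE si orbT.
Qed.

Lemma mcs_bigor (I : finType) (P : pred I) F :
  G (\big[Or/Bot]_(i | P i) F i) -> exists2 i, P i & G (F i).
Proof.
rewrite -big_filter => h.
have [i] : exists2 i, i \in [seq i <- index_enum I | P i] & G (F i).
  elim: [seq i <- _ | _] h => [|j s IH].
    by rewrite big_nil; case: mG.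
  rewrite big_cons => /mcs_or[|/IH[i si]]; first by exists j; rewrite ?mem_head.
  by exists i => //; rewrite inE si orbT.
by rewrite mem_filter => /andP[Pi _]; exists i.
Qed.

End Mcs.

Hypothesis bwL : L (bw_back 2).

(* [tense_logic] has no axiom relating [Past f] and [Past (Neg (Neg f))]. The
   back-width axiom with all variables replaced by [f] supplies one: [Past f]
   implies [Past] of a conjunction, which is a negation and hence governed
   by the normality of [PBox]. *)
Lemma mcs_past_pbox G f : mcs G -> G (Past f) -> ~ G (PBox (Neg f)).
Proof.
move=> mG Pf Hnf.
have := mcs_logic mG (tl_subst tL (fun _ => f) bwL).
rewrite /bw_back /bw /= subst_bigand subst_bigor /=.
move=> /(mcs_imp mG) bwf.
have /bwf/(mcs_bigor mG)[i _] : G (\big[And/Top]_(i < 3) Past f).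
  by apply/(mcs_bigand mG).
rewrite subst_bigor => /(mcs_bigor mG)[j _ /= ffP].
have : G (PBox (Imp f (Neg (Or f (Past f))))).
  apply: (mcs_mp mG _ Hnf).
  apply: (mcs_mp mG (mcs_logic mG (tl_pboxK tL _ _))).
  by apply: (mcs_logic mG); apply: (tl_pbox_nec tL); apply: (tl_taut tL); taut_tac.
by move=> /(mcs_neg mG).
Qed.

Definition canon : Type := {G : set form | mcs G}.

Definition canonR (G D : canon) : Prop := forall f, sval G (Box f) -> sval D f.

Definition canonV (n : nat) : set canon := [set G | sval G (Var n)].

Lemma canonR_ex_box (G : canon) f : ~ sval G (Box f) ->
  exists2 D, canonR G D & ~ sval D f.
Proof.
case: G => G mG /= nBf.
(* The theory generated by [Neg f] and all [g] with [Box g] in [G], written so that its closure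
   under modus ponens is an instance of normality. *)
pose D0 := [set g | G (Box (Imp (Neg f) g))].
have Dtaut g : tautology (Imp (Neg f) g) -> D0 g.
  by move=> t; apply: (mcs_logic mG); apply: (tl_box_nec tL); exact: (tl_taut tL).
have D0mp g h : D0 (Imp g h) -> D0 g -> D0 h.
  move=> gh g'; apply: (mcs_mp mG _ g').
  apply: (mcs_mp mG (mcs_logic mG (tl_boxK tL _ _))).
  apply: (mcs_mp mG _ gh); apply: (mcs_mp mG (mcs_logic mG (tl_boxK tL _ _))).
  by apply: (mcs_logic mG); apply: (tl_box_nec tL); apply: (tl_taut tL); taut_tac.
have D0box g : G (Box g) -> D0 g.
  move=> Gg; apply: (mcs_mp mG _ Gg).
  apply: (mcs_mp mG (mcs_logic mG (tl_boxK tL _ _))).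
  by apply: (mcs_logic mG); apply: (tl_box_nec tL); apply: (tl_taut tL); taut_tac.
have [||D mD D0D] := @lindenbaum D0.
- split=> // g Lg; apply: D0box; apply: (mcs_logic mG); exact: (tl_box_nec tL).
- move=> /= D0B; apply: nBf; apply: (mcs_mp mG _ D0B).
  apply: (mcs_mp mG (mcs_logic mG (tl_boxK tL _ _))).
  by apply: (mcs_logic mG); apply: (tl_box_nec tL); apply: (tl_taut tL); taut_tac.
exists (exist _ D mD) => [g /= Gg|/=]; first exact/D0D/D0box.
by apply/(mcs_neg mD)/D0D/Dtaut; taut_tac.
Qed.

Lemma canonR_ex_past (G : canon) f : sval G (Past f) ->
  exists2 D, canonR D G & sval D f.
Proof.
case: G => G mG /= Pf.
(* The past analogue. Its consistency says that [PBox (Neg f)] is not in [G], which is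
   [mcs_past_pbox]. *)
pose D0 := [set g | G (PBox (Imp f g))].
have D0mp g h : D0 (Imp g h) -> D0 g -> D0 h.
  move=> gh g'; apply: (mcs_mp mG _ g').
  apply: (mcs_mp mG (mcs_logic mG (tl_pboxK tL _ _))).
  apply: (mcs_mp mG _ gh); apply: (mcs_mp mG (mcs_logic mG (tl_pboxK tL _ _))).
  by apply: (mcs_logic mG); apply: (tl_pbox_nec tL); apply: (tl_taut tL); taut_tac.
have D0pbox g : G (PBox g) -> D0 g.
  move=> Gg; apply: (mcs_mp mG _ Gg).
  apply: (mcs_mp mG (mcs_logic mG (tl_pboxK tL _ _))).
  by apply: (mcs_logic mG); apply: (tl_pbox_nec tL); apply: (tl_taut tL); taut_tac.
have [||D mD D0D] := @lindenbaum D0.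
- split=> // g Lg; apply: D0pbox; apply: (mcs_logic mG); exact: (tl_pbox_nec tL).
- exact: mcs_past_pbox.
exists (exist _ D mD) => [g /= Dg|/=]; last first.
  apply: D0D; apply: (mcs_logic mG); apply: (tl_pbox_nec tL).
  by apply: (tl_taut tL); taut_tac.
apply: contrapT => /(mcs_neg mG) nGg.
(* Since [canonR] is defined through [Box] alone, the converse axiom for the past must turn the
   failure of [g] in [G] into a failure of [Box g] in [D]. *)
have : D (Dia (Neg g)).
  by apply/D0D/D0pbox; apply: (mcs_mp mG _ nGg); apply: (mcs_logic mG);
     exact: (tl_conv_past tL).
move=> /(mcs_neg mD); apply; apply: (mcs_mp mD _ Dg).
apply: (mcs_mp mD (mcs_logic mD (tl_boxK tL _ _))).
by apply: (mcs_logic mD); apply: (tl_box_nec tL); apply: (tl_taut tL); taut_tac.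
Qed.

Lemma canon_truth f (G : canon) : sat canonR canonV G f <-> sval G f.
Proof.
elim: f G => [n||f IHf g IHg|f IH|f IH] G //=.
- by split=> //; case: G => G [].
- by rewrite IHf IHg; split; move/(mcs_imp (svalP G)).
- split=> [h|Bf D GD]; last by apply/IH/GD.
  apply: contrapT => /canonR_ex_box[D GD nDf].
  by apply: nDf; apply/IH/h.
- split=> [[D DG /IH Df]|/canonR_ex_past[D DG Df]]; last by exists D => //; apply/IH.
  apply: DG; apply: (mcs_mp (svalP D)) Df.
  by apply: (mcs_logic (svalP D)); exact: (tl_conv_future tL).
Qed.

Lemma canon_complete f : ~ L f -> exists G : canon, ~ sval G f.
Proof.
move=> nLf; have [||G mG DG] := @lindenbaum [set g | L (Imp (Neg f) g)].
- split=> [g Lg|g h gh g'] /=.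
    by apply: (tl_mp tL _ Lg); apply: (tl_taut tL); taut_tac.
  apply: (tl_mp tL _ g'); apply: (tl_mp tL _ gh).
  by apply: (tl_taut tL); taut_tac.
- move=> /= LB; apply: nLf; apply: (tl_mp tL _ LB).
  by apply: (tl_taut tL); taut_tac.
exists (exist _ G mG) => /=; apply/(mcs_neg mG)/DG => /=.
by apply: (tl_taut tL); taut_tac.
Qed.

End Canonical.

(* The three conditions say that the model is a descriptive general frame for
   [L], compactness excepted. *)
Record refined (L : set form) (T : Type) (R : T -> T -> Prop)
    (V : nat -> set T) : Prop := Refined {
  refined_sound : forall f, L f -> forall x, sat R V x f;
  refined_diff : forall x y, x <> y ->
    exists2 f, sat R V x f & ~ sat R V y f;
  refined_tight : forall x y, ~ R x y ->
    exists2 f, sat R V x (Box f) & ~ sat R V y f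
}.

Lemma refined_complete (L : set form) f : tense_logic L -> L (bw_back 2) ->
  ~ L f ->
  exists (T : choiceType) (R : T -> T -> Prop) (V : nat -> set T) (x : T),
    refined L R V /\ ~ sat R V x f.
Proof.
move=> tL bwL /(canon_complete tL)[G nGf].
have tr := @canon_truth L tL bwL.
(* The classical choice structure serves later to list finite balls and to pick representatives of
   clusters. *)
exists {classic (canon L)}, (@canonR L), (@canonV L), G.
split; last by rewrite tr.
split.
- move=> g Lg x; apply/tr; exact: (mcs_logic (svalP x)).
- move=> x y xy; apply: contrapT => h; apply: xy.
  suff : sval x = sval y by case: (x) (y) => [? ?] [? ?]; exact: eq_exist.
  rewrite predeqE => g; split=> xg; apply: contrapT => ng; apply: h.
    by exists g; rewrite tr.
  exists (Neg g); rewrite tr; first exact/(mcs_neg (svalP x)).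
  by move=> /(mcs_neg (svalP y)).
- move=> x y xy; apply: contrapT => h; apply: xy => g xg; apply: contrapT => ng.
  by apply: h; exists g; rewrite tr.
Qed.

(** * Frames of depth and widths at most two *)

Record frame22 (T : Type) (R : T -> T -> Prop) : Prop := Frame22 {
  fr_refl : forall x, R x x;
  fr_trans : forall x y z, R x y -> R y z -> R x z;
  fr_depth : forall x y z, R x y -> R y z -> R y x \/ R z y;
  fr_forth : forall x (y : 'I_3 -> T), (forall i, R x (y i)) ->
    exists i j, i != j /\ R (y i) (y j);
  fr_back : forall x (y : 'I_3 -> T), (forall i, R (y i) x) ->
    exists i j, i != j /\ R (y i) (y j)
}.

(** Order duality: what is shown for successors carries over to predecessors. *)
Lemma frame22_flip (T : Type) (R : T -> T -> Prop) :
  frame22 R -> frame22 (fun x y => R y x).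
Proof.
case=> rR tR dR fR bR; split=> //.
- by move=> x y z xy yz; exact: tR yz xy.
- by move=> x y z xy yz; case: (dR z y x yz xy); [right | left].
- by move=> x y /bR[i [j [ij yij]]]; exists j, i; rewrite eq_sym.
- by move=> x y /fR[i [j [ij yij]]]; exists j, i; rewrite eq_sym.
Qed.

Lemma frame22_preim (T W : Type) (R : T -> T -> Prop) (p : W -> T) :
  frame22 R -> frame22 (fun x y => R (p x) (p y)).
Proof.
case=> rR tR dR fR bR; split=> //.
- by move=> x y z; exact: tR.
- by move=> x y z; exact: dR.
- by move=> x y /(fR (p x) (p \o y)).
- by move=> x y /(bR (p x) (p \o y)).
Qed.

Lemma S4BP_frame22 (T : Type) (R : T -> T -> Prop) :
  frame22 R -> S4BP_2omega_22 `<=` Log R.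
Proof.
case=> rR tR dR fR bR f; apply; first exact: tense_logic_Log.
- move=> g; apply; first exact: tense_logic_Log.
    by move=> h; apply; exact: tense_logic_Log.
  move=> _ [->|->] V x /= h; first exact: h.
  by move=> y xy z yz; apply/h/tR/yz.
- move=> _ [[->|->]|->] V x.
  + rewrite /bd2 /bd1; apply/sat_imp => /sat_dia[y xy] /sat_and[yp nbd].
     apply: contrapT => nx; apply: (sat_neg.1 nbd).
    apply/sat_imp => /sat_dia[z yz zp].
    by case: (dR x y z xy yz) => [/yp|/zp].
  + rewrite /bw_forth /bw; apply/sat_imp => /sat_bigand_ord h.
    have /choice[y yP] : forall i : 'I_3, exists y, R x y /\ V i y.
      by move=> i; have /sat_dia[y xy yi] := h i isT; exists y.
    have [i [j [ij yij]]] := fR x y (fun i => (yP i).1).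
    apply/sat_bigor_ord; exists i => //; apply/sat_bigor_ord; exists j => //.
    apply/sat_dia; exists (y i); first exact: (yP i).1.
    apply/sat_and; split; first exact: (yP i).2.
    apply/sat_or; right; apply/sat_dia; exists (y j) => //; exact: (yP j).2.
  + rewrite /bw_back /bw; apply/sat_imp => /sat_bigand_ord h.
    have /choice[y yP] : forall i : 'I_3, exists y, R y x /\ V i y.
      by move=> i; have [y xy yi] := h i isT; exists y.
    have [i [j [ij yij]]] := bR x y (fun i => (yP i).1).
    apply/sat_bigor_ord; exists j => //.
    apply/sat_bigor_ord; exists i; first by rewrite eq_sym.
    exists (y j); first exact: (yP j).1.
    apply/sat_and; split; first exact: (yP j).2.
    apply/sat_or; right; exists (y i) => //; exact: (yP i).2.
Qed.

Lemma S4BP_axT : S4BP_2omega_22 axT.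
Proof. by move=> L tL S4L _; apply: S4L => L' _ _; apply; left. Qed.

Lemma S4BP_ax4 : S4BP_2omega_22 ax4.
Proof. by move=> L tL S4L _; apply: S4L => L' _ _; apply; right. Qed.

Lemma S4BP_bd2 : S4BP_2omega_22 bd2.
Proof. by move=> L tL _; apply; left; left. Qed.

Lemma S4BP_bw_forth : S4BP_2omega_22 (bw_forth 2).
Proof. by move=> L tL _; apply; left; right. Qed.

Lemma S4BP_bw_back : S4BP_2omega_22 (bw_back 2).
Proof. by move=> L tL _; apply; right. Qed.

Lemma refined_subst (L : set form) (T : Type) (R : T -> T -> Prop) V f s x :
  tense_logic L -> refined L R V -> L f ->
  sat R (fun n y => sat R V y (s n)) x f.
Proof.
by move=> tL rV Lf; apply/sat_subst; apply: (refined_sound rV); exact: tl_subst.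
Qed.

(** A violated frame condition exhibits unrelated points. [refined_tight] separates them by
    formulas, and substituting these formulas into the axiom contradicts soundness. *)
Lemma refined_frame22 (L : set form) (T : Type) (R : T -> T -> Prop) V :
  tense_logic L -> S4BP_2omega_22 `<=` L -> refined L R V -> frame22 R.
Proof.
move=> tL LS rV.
have sound f s x : S4BP_2omega_22 f -> sat R (fun n y => sat R V y (s n)) x f.
  by move=> /LS; exact: (refined_subst _ _ tL rV).
have rR x : R x x.
  apply: contrapT => /(refined_tight rV)[f /= bf]; apply.
  exact: (sound _ (fun _ => f) x S4BP_axT).
(* Three pairwise unrelated points satisfy formulas [p i] such that no point of [p i] is related, in
   either direction, to a point of another [p j]. *)
have incomp (y : 'I_3 -> T) :
    ~ (exists i j, i != j /\ R (y i) (y j)) ->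
    exists p : 'I_3 -> form, [/\ forall i, sat R V (y i) (p i),
      forall i j z u, i != j -> R z u -> sat R V z (p i) -> ~ sat R V u (p j)
      & forall i j z u, i != j -> R u z -> sat R V z (p i) -> ~ sat R V u (p j)].
  move=> nR.
  have /choice[e eP] : forall ij : 'I_3 * 'I_3, exists f, ij.1 != ij.2 ->
      sat R V (y ij.1) (Box f) /\ ~ sat R V (y ij.2) f.
    case=> i j /=; case: (altP (i =P j)) => ij; first by exists Bot.
    have [|f] := @refined_tight _ _ _ _ rV (y i) (y j); last by exists f.
    by move=> yij; apply: nR; exists i, j.
  (* [p i] carries [Box (e (i, j))] and [p j] carries [Neg (e (i, j))], so a point of [p j] cannot
     lie above a point of [p i]. *)
  pose p i := \big[And/Top]_(j < 3 | j != i) And (Box (e (i, j))) (Neg (e (j, i))).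
  have sp i z : sat R V z (p i) -> forall j, j != i ->
      sat R V z (Box (e (i, j))) /\ ~ sat R V z (e (j, i)).
    by move=> /sat_bigand_ord h j ji; have /sat_and[] := h j ji.
  exists p; split.
  - move=> i; apply/sat_bigand_ord => j ji; apply/sat_and; split.
      by rewrite eq_sym in ji; exact: (eP (i, j) ji).1.
    by apply/sat_neg; exact: (eP (j, i) ji).2.
  - move=> i j z u ij zu /sp h /sp k.
    have ji : j != i by rewrite eq_sym.
    exact: (k i ij).2 ((h j ji).1 u zu).
  - move=> i j z u ij uz /sp h /sp k.
    have ji : j != i by rewrite eq_sym.
    exact: (h j ji).2 ((k i ij).1 z uz).
split=> //.
- move=> x y z xy yz; apply: contrapT => /(refined_tight rV)[f bf]; apply.
  exact: (sound _ (fun _ => f) x S4BP_ax4 bf y xy z yz).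
- move=> x y z xy yz; apply: contrapT => /not_orP[nyx nzy].
  have [f yf nf] := refined_tight rV nyx; have [g zg ng] := refined_tight rV nzy.
  (* [f] holds everywhere above [y] but not at [x], and [g] everywhere above [z] but not at [y];
     hence [y] refutes the instance of [bd1] and [x] that of [bd2]. *)
  apply: nf; pose s n := if n is 0 then g else f.
  have := sound _ s x S4BP_bd2; rewrite /bd2 /bd1 => /sat_imp.
  apply; apply/sat_dia; exists y => //; apply/sat_and; split; first exact: yf.
  by apply/sat_neg => /sat_imp h; apply: ng; apply: h; apply/sat_dia; exists z.
- move=> x y xy; apply: contrapT => /incomp[p [py p1 _]].
  have := sound _ (fun n => p (inord n)) x S4BP_bw_forth.
  have /[swap] /[apply] : sat R (fun n z => sat R V z (p (inord n))) x
      (\big[And/Top]_(i < 3) Dia (Var i)).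
    apply/sat_bigand_ord => i _; apply/sat_dia; exists (y i) => //.
    by rewrite /= inord_val.
  move=> /sat_bigor_ord[i _ /sat_bigor_ord[j ij /sat_dia[z xz]]].
  move=> /sat_and[+ /sat_or[|/sat_dia[u zu]]]; rewrite /= !inord_val => zi zj.
    exact: p1 zi zj.
  exact: p1 zi zj.
- move=> x y xy; apply: contrapT => /incomp[p [py _ p1]].
  have := sound _ (fun n => p (inord n)) x S4BP_bw_back.
  have /[swap] /[apply] : sat R (fun n z => sat R V z (p (inord n))) x
      (\big[And/Top]_(i < 3) Past (Var i)).
    apply/sat_bigand_ord => i _; exists (y i) => //.
    by rewrite /= inord_val.
  move=> /sat_bigor_ord[i _ /sat_bigor_ord[j ij /sat_past[z xz]]].
  move=> /sat_and[+ /sat_or[|/sat_past[u uz]]]; rewrite /= !inord_val => zi zj.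
    exact: p1 zi zj.
  exact: p1 zi zj.
Qed.

(** * Zigzag balls *)

Section Balls.
Variables (T : Type) (R : T -> T -> Prop).

Definition adj (x y : T) : Prop := R x y \/ R y x.

Definition eqc (x y : T) : Prop := R x y /\ R y x.

Fixpoint ball (n : nat) (x y : T) : Prop :=
  if n is m.+1 then exists2 z, ball m x z & adj z y else x = y.

Lemma adjC x y : adj x y -> adj y x.
Proof. by case; [right | left]. Qed.

Lemma eqcC x y : eqc x y -> eqc y x.
Proof. by case. Qed.

Lemma ball_cat m n x y z : ball m x y -> ball n y z -> ball (m + n) x z.
Proof.
elim: n z => [|n IH] z xy; first by move=> <-; rewrite addn0.
by rewrite addnS => -[u yu uz]; exists u => //; exact: IH.
Qed.

Lemma ball1 x y : adj x y -> ball 1 x y.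
Proof. by move=> xy; exists x. Qed.

Lemma ballC n x y : ball n x y -> ball n y x.
Proof.
elim: n x y => [|n IH] x y; first by move=> ->.
by move=> [z /IH xz /adjC zy]; apply: (@ball_cat 1 n) xz; exact: ball1.
Qed.

Lemma ball_path n x y : ball n x y ->
  exists c : nat -> T, [/\ c 0 = x, c n = y & forall i, i < n -> adj (c i) (c i.+1)].
Proof.
elim: n y => [|n IH] y; first by move=> <-; exists (fun _ => x).
case=> z /IH[c [c0 cn cP]] zy.
exists (fun i => if i == n.+1 then y else c i); split=> //; first by rewrite eqxx.
move=> i; rewrite ltnS leq_eqVlt => /orP[/eqP ->|iltn].
  by rewrite eqxx eqn_leq ltnn andbF cn.
by rewrite eqSS (ltn_eqF iltn) (ltn_eqF (leqW iltn)); exact: cP.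
Qed.

Hypothesis frR : frame22 R.
Let rR := fr_refl frR.
Let tR := fr_trans frR.

Lemma eqc_refl x : eqc x x.
Proof. by split; exact: rR. Qed.

Lemma eqc_trans x y z : eqc x y -> eqc y z -> eqc x z.
Proof. by move=> [xy yx] [yz zy]; split; [exact: tR yz | exact: tR yx]. Qed.

Lemma eqc_adj x y z : eqc x y -> adj y z -> adj x z.
Proof. by move=> [xy yx] [yz|zy]; [left; exact: tR yz | right; exact: tR yx]. Qed.

Lemma adj_eqc x y z : adj x y -> eqc y z -> adj x z.
Proof. by move=> /adjC xy /eqcC yz; apply/adjC/(eqc_adj yz). Qed.

Lemma adj_refl x : adj x x.
Proof. by left. Qed.

Lemma ball_refl n x : ball n x x.
Proof. by elim: n => // n IH; exists x => //; exact: adj_refl. Qed.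

Lemma ball_le m n x y : m <= n -> ball m x y -> ball n x y.
Proof.
by move=> mn xy; rewrite -(subnKC mn); apply: ball_cat xy _; exact: ball_refl.
Qed.

Lemma ball_eqc n x y z : 0 < n -> ball n x y -> eqc y z -> ball n x z.
Proof. by case: n => // n _ [u xu uy] yz; exists u => //; exact: adj_eqc yz. Qed.

End Balls.

Definition Zig (f : form) : form := Or (Dia f) (Past f).

Lemma sat_zig (T : Type) (R : T -> T -> Prop) V x n f :
  sat R V x (iter n Zig f) <-> exists2 y, ball R n x y & sat R V y f.
Proof.
elim: n f => [|n IH] f; first by split=> [h|[y <-]]; [exists x|].
rewrite iterSr IH; split=> [[y xy /sat_or[/sat_dia|]]|[z [y xy] [yz|zy] fz]].
- by case=> z yz fz; exists z => //; exists y => //; left.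
- by case=> z yz fz; exists z => //; exists y => //; right.
- by exists y => //; apply/sat_or; left; apply/sat_dia; exists z.
- by exists y => //; apply/sat_or; right; exists z.
Qed.

Lemma subst_zig s n f : subst s (iter n Zig f) = iter n Zig (subst s f).
Proof. by elim: n => //= n ->. Qed.

(** * Definable valuations and tabularity *)

(** Substitution can thus replace a valuation on the finite index set by formulas of the model. This
    is how theorems of the logic become valid on frames extracted from a refined model. *)
Lemma definable_valuation (T : Type) (R : T -> T -> Prop) V (I : finType)
    (A : I -> set T) :
  (forall i j, i <> j -> exists f,
     (forall x, A i x -> sat R V x f) /\ (forall x, A j x -> ~ sat R V x f)) ->
  forall U : nat -> set I, exists s : nat -> form,
  forall p j x, A j x -> (sat R V x (s p) <-> U p j).
Proof.
move=> sep U.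
have /choice[e eP] : forall ij : I * I, exists f, ij.1 <> ij.2 ->
    (forall x, A ij.1 x -> sat R V x f) /\ (forall x, A ij.2 x -> ~ sat R V x f).
  case=> i j /=; case: (pselect (i = j)) => [ij|/sep[f fP]]; last by exists f.
  by exists Bot.
(* On the union of the classes, [d i] holds exactly on the class [A i]. *)
pose d i := \big[And/Top]_(j <- index_enum I | j != i) e (i, j).
have dP i j x : A j x -> sat R V x (d i) <-> i = j.
  move=> Ajx; split=> [/sat_bigand h|->].
    apply: contrapT => ij; have := h j (mem_index_enum _).
    have -> : j != i by apply/eqP => ji; exact: ij.
    by move=> /(_ isT); exact: (eP (i, j) ij).2.
  apply/sat_bigand => k _ /eqP kj; apply: (eP (j, k) _).1 => // jk.
  by apply: kj.
exists (fun p => \big[Or/Bot]_(i | `[< U p i >]) d i) => p j x Ajx.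
rewrite sat_bigor_ord; split=> [[i /asboolP Upi /(dP _ _ _ Ajx) <-] //|Upj].
by exists j; [exact/asboolP | exact/(dP _ _ _ Ajx)].
Qed.

Lemma definable_valuation_points L (T : Type) (R : T -> T -> Prop) V
    (I : finType) (c : I -> T) : refined L R V -> injective c ->
  forall U : nat -> set I, exists s : nat -> form,
  forall p j, sat R V (c j) (s p) <-> U p j.
Proof.
move=> rV cI U.
have [|s sP] := @definable_valuation T R V I (fun i => [set c i]) _ U.
  move=> i j ij; have [|f fi fj] := @refined_diff _ _ _ _ rV (c i) (c j).
    by move=> /cI.
  by exists f; split=> _ ->.
by exists s => p j; exact: sP.
Qed.

(* Refuted at [x] iff the ball of radius [n] around [x] has more than [n]
   points. *)
Definition Tab (n : nat) : form :=
  Neg (\big[And/Top]_(i < n.+1) iter n Zig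
         (And (Var i) (\big[And/Top]_(j < n.+1 | j != i) Neg (Var j)))).

Lemma sat_Tab (T : Type) (R : T -> T -> Prop) V n x :
  ~ sat R V x (Tab n) -> exists2 c : 'I_n.+1 -> T, injective c &
    forall i, ball R n x (c i).
Proof.
rewrite /Tab => /contrapT/sat_bigand_ord h.
have /choice[c cP] : forall i : 'I_n.+1, exists y, ball R n x y /\
    (V i y /\ forall j : 'I_n.+1, j != i -> ~ V j y).
  move=> i; have /sat_zig[y xy /sat_and[Vy /sat_bigand_ord nV]] := h i isT.
  by exists y.
exists c => [i j cij|i]; last exact: (cP i).1.
apply/eqP; apply: contrapT => /negP ij.
have [_ [_ /(_ _ ij)]] := cP j; rewrite -cij; apply; exact: (cP i).2.1.
Qed.

Lemma Tab_sat (T : Type) (R : T -> T -> Prop) (V : nat -> set T) n x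
    (c : 'I_n.+1 -> T) :
  (forall i, ball R n x (c i)) ->
  (forall i j : 'I_n.+1, V i (c j) <-> i = j) -> ~ sat R V x (Tab n).
Proof.
move=> xc Vc; apply; apply/sat_bigand_ord => i _; apply/sat_zig.
exists (c i) => //; apply/sat_and; split; first by apply/Vc.
by apply/sat_bigand_ord => j ji /= /Vc jI; rewrite jI eqxx in ji.
Qed.

Lemma Log_Tab (T : finType) (R : T -> T -> Prop) n :
  #|T| <= n -> Log R (Tab n).
Proof.
move=> Tn V x; apply: contrapT => h; have [c cI _] := sat_Tab h.
have : n.+1 <= n; last by rewrite ltnn.
by apply: leq_trans Tn; rewrite -[n.+1]card_ord; exact: leq_card cI.
Qed.

Lemma notin_Log_Tab (T : Type) (R : T -> T -> Prop) n x (c : 'I_n.+1 -> T) :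
  injective c -> (forall i, ball R n x (c i)) -> ~ Log R (Tab n).
Proof.
move=> cI xc; pose V k := [set c (inord k)] : set T.
move=> /(_ V x); apply: (Tab_sat xc) => i j; rewrite /V /= inord_val.
by split=> [/cI|->].
Qed.

Lemma refined_Tab L (T : Type) (R : T -> T -> Prop) V n x (c : 'I_n.+1 -> T) :
  tense_logic L -> refined L R V -> L (Tab n) -> injective c ->
  ~ (forall i, ball R n x (c i)).
Proof.
move=> tL rV Ln cI xc.
have [s sP] := definable_valuation_points rV cI (fun k => [set i | k = i :> nat]).
apply: (Tab_sat xc) (refined_subst s x tL rV Ln) => i j.
by rewrite sP /=; split=> [/val_inj|->].
Qed.

Lemma Log_sum (T1 T2 : Type) (R1 : T1 -> T1 -> Prop) (R2 : T2 -> T2 -> Prop) :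
  Log (fun x y : T1 + T2 => match x, y with
       | inl a, inl b => R1 a b | inr a, inr b => R2 a b | _, _ => False end)
  = Log R1 `&` Log R2.
Proof.
set R := (X in Log X).
have R1P V x f : sat R V (inl x) f <-> sat R1 (fun n y => V n (inl y)) x f.
  apply: (@bisim_sat _ _ _ _ _ _ (fun _ u y => u = inl y)) (leqnn _) _ => //.
    by move=> _ _ y p ->.
  move=> _ _ y ->; split=> //.
  - by case=> // z yz; exists z.
  - by move=> z yz; exists (inl z).
  - by case=> // z yz; exists z.
  - by move=> z yz; exists (inl z).
have R2P V x f : sat R V (inr x) f <-> sat R2 (fun n y => V n (inr y)) x f.
  apply: (@bisim_sat _ _ _ _ _ _ (fun _ u y => u = inr y)) (leqnn _) _ => //.
    by move=> _ _ y p ->.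
  move=> _ _ y ->; split=> //.
  - by case=> // z yz; exists z.
  - by move=> z yz; exists (inr z).
  - by case=> // z yz; exists z.
  - by move=> z yz; exists (inr z).
apply/seteqP; split=> f.
  move=> h; split=> V x.
    have /R1P := h (fun n u => if u is inl y then V n y else False) (inl x).
    by [].
  have /R2P := h (fun n u => if u is inr y then V n y else False) (inr x).
  by [].
by move=> [h1 h2] V [x|x]; [apply/R1P; exact: h1 | apply/R2P; exact: h2].
Qed.

Lemma tabular_setI L1 L2 : tabular L1 -> tabular L2 -> tabular (L1 `&` L2).
Proof.
case=> T1 [R1 ->] [T2 [R2 ->]]; rewrite -Log_sum.
by exists (T1 + T2)%type; eexists.
Qed.

Lemma tabular_setT : tabular setT.
Proof. by exists void, (fun _ _ => False); apply/seteqP; split=> // f _ V []. Qed.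

Lemma tabular_bigcap (I : finType) (P : set I) (L : I -> set form) :
  (forall i, P i -> tabular (L i)) -> tabular (\bigcap_(i in P) L i).
Proof.
move=> tL.
have -> : \bigcap_(i in P) L i = \big[setI/setT]_(i : I | `[< P i >]) L i.
  rewrite -bigcap_seq_cond; apply/seteqP; split=> f h i.
    by move=> /= /andP[_ /asboolP Pi]; exact: h.
  by move=> Pi; apply: h => /=; rewrite mem_index_enum; apply/asboolP.
elim/big_ind: _ => [||i /asboolP]; [exact: tabular_setT| exact: tabular_setI|].
exact: tL.
Qed.

(** A longest duplicate-free list inside [A] exists because lengths are bounded by [n]; by
    maximality it contains every element of [A]. *)
Lemma finite_listing (T : choiceType) (A : set T) n :
  (forall c : 'I_n.+1 -> T, injective c -> ~ (forall i, A (c i))) ->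
  exists2 m, m <= n & exists2 c : 'I_m -> T, injective c &
    forall y, A y <-> exists i, c i = y.
Proof.
move=> small.
pose P m := `[< exists l : seq T, [/\ uniq l, size l = m &
   forall y, y \in l -> A y] >].
have Pn m : P m -> m <= n.
  move=> /asboolP[l [ul sl lA]]; rewrite leqNgt; apply/negP => nm.
  have ltl (i : 'I_n.+1) : i < size l by rewrite sl; exact: leq_trans nm.
  case: l ul sl lA ltl => [|x l0] ul sl lA ltl; first by have := ltl ord0.
  apply: (small (fun i : 'I_n.+1 => nth x (x :: l0) i)).
    by move=> i j /eqP; rewrite nth_uniq // => /eqP/val_inj.
  by move=> i; apply/lA/mem_nth.
have P0 : exists m, P m by exists 0; apply/asboolP; exists [::].
case: (ex_maxnP P0 Pn) => m Pm mmax; exists m; first exact: Pn.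
have /asboolP[l [ul sl lA]] := Pm.
have Al y : A y -> y \in l.
  move=> Ay; apply: contrapT => /negP yl.
  suff /mmax : P m.+1 by rewrite ltnn.
  apply/asboolP; exists (y :: l); split; rewrite /= ?yl ?sl //.
  by move=> z; rewrite inE => /orP[/eqP ->|/lA].
exists (fun i => tnth (Tuple (introT eqP sl)) i).
  by apply/tuple_uniqP.
move=> y; split=> [/Al yl|[i <-]]; last by apply: lA; exact: mem_tnth.
by have /tnthP[i ->] : y \in Tuple (introT eqP sl) by []; exists i.
Qed.

Section Paths.
Variables (T : Type) (R : T -> T -> Prop).
Hypothesis frR : frame22 R.

Lemma path_ball (c : nat -> T) N i j :
  (forall k, k < N -> adj R (c k) (c k.+1)) -> i <= j <= N ->
  ball R (j - i) (c i) (c j).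
Proof.
move=> cP /andP[ij]; rewrite -{1 3}(subnKC ij).
elim: (j - i) => [|d IH]; first by rewrite addn0.
rewrite addnS => dN; exists (c (i + d)); last exact: cP.
by apply: IH; exact: ltnW.
Qed.

(* Otherwise a path of length [n.+1] that cannot be shortened has [n.+1] distinct
   points in the ball. *)
Lemma small_ball_closed n x y z :
  (forall c : 'I_n.+1 -> T, injective c -> ~ (forall i, ball R n x (c i))) ->
  ball R n x y -> adj R y z -> ball R n x z.
Proof.
move=> small xy yz; apply: contrapT => nxz.
have [c [c0 cn cP]] : exists c, [/\ c 0 = x, c n.+1 = z &
    forall i, i < n.+1 -> adj R (c i) (c i.+1)] by apply: ball_path; exists y.
have short i j : i < j -> j <= n -> c i <> c j.
  move=> ij jn cij; apply: nxz; rewrite -c0 -cn.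
  apply: (@ball_le _ _ frR (i - 0 + (n.+1 - j))); first by lia.
  by apply: (@ball_cat _ _ _ _ _ (c i)); [|rewrite cij]; apply: (path_ball cP); lia.
apply: (small (fun i => c i)) => [i j cij|i].
  apply/val_inj; apply: contrapT => /eqP; rewrite neq_ltn => /orP[] ij.
    by apply: (short _ _ ij) cij; rewrite -ltnS ltn_ord.
  by apply: (short _ _ ij) (esym cij); rewrite -ltnS ltn_ord.
rewrite -c0; apply: (@ball_le _ _ frR (i - 0)); first by have := ltn_ord i; lia.
by apply: (path_ball cP); have := ltn_ord i; lia.
Qed.

End Paths.

(** Coding relations by finite functions makes the frames on ['I_m] a finite type. *)
Definition code_rel m (r : {ffun 'I_m * 'I_m -> bool}) (i j : 'I_m) : Prop :=
  r (i, j).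

(** Components of refined models have at most [n] points. So [L] is the intersection of those logics
    of frames with at most [n] points that extend it, and these are finitely many. *)
Lemma Tab_tabular L n :
  tense_logic L -> S4BP_2omega_22 `<=` L -> L (Tab n) -> tabular L.
Proof.
move=> tL LS Ln.
pose K (a : {m : 'I_n.+1 & {ffun 'I_m * 'I_m -> bool}}) :=
  Log (code_rel (tagged a)).
suff -> : L = \bigcap_(a in [set a | L `<=` K a]) K a.
  by apply: tabular_bigcap => a _; exists 'I_(tag a), (code_rel (tagged a)).
apply/seteqP; split=> [f Lf a|f fK]; first exact.
apply: contrapT => /(refined_complete tL (LS _ S4BP_bw_back)).
move=> [T [R [V [x [rV nf]]]]]; apply: nf.
have frR := refined_frame22 tL LS rV.
have small c : injective c -> ~ (forall i : 'I_n.+1, ball R n x (c i)).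
  exact: refined_Tab tL rV Ln.
have [m mn [c cI cP]] := finite_listing small.
pose r := [ffun ij => `[< R (c ij.1) (c ij.2) >]].
(* The listed ball is closed under adjacency, hence a generated subframe on which truth can be
   computed. *)
have simul V' U : (forall p i, V' p (c i) <-> U p i) ->
    forall f i, sat R V' (c i) f <-> sat (@code_rel m r) U i f.
  move=> VU g i; apply: (@bisim_sat _ _ _ _ _ _ (fun _ y i => y = c i))
    (leqnn _) _ => //; first by move=> _ _ k p ->.
  have adjP k y : adj R (c k) y -> exists l, c l = y.
    move=> ky; apply/cP; apply: (small_ball_closed frR small) ky.
    by apply/cP; exists k.
  move=> _ _ k ->; split.
  - move=> y ky; have [l ly] : exists l, c l = y by apply: (adjP k); left.
    by exists l => //; rewrite /code_rel ffunE ly; apply/asboolP.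
  - by move=> l; rewrite /code_rel ffunE => /asboolP kl; exists (c l).
  - move=> y ky; have [l ly] : exists l, c l = y by apply: (adjP k); right.
    by exists l => //; rewrite /code_rel ffunE ly; apply/asboolP.
  - by move=> l; rewrite /code_rel ffunE => /asboolP kl; exists (c l).
have rK : L `<=` K (existT _ (Ordinal (mn : m < n.+1)) r).
  move=> g Lg U i; have [s sP] := definable_valuation_points rV cI U.
  by apply/(simul (fun p y => sat R V y (s p)) U sP); exact: refined_subst rV Lg.
have [i <-] : exists i, c i = x by apply/cP; exact: ball_refl.
by apply/(simul V (fun p i => V p (c i))) => //; exact: (fK _ rK).
Qed.

(** The index is made positive so that the ball in [Tab] has radius at least one and contains the
    whole cluster of its centre, as [blow_not_tabular] requires. *)
Lemma tabular_Tab L : tabular L -> exists n, L (Tab n.+1).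
Proof. by case=> T [R ->]; exists #|T|; apply: Log_Tab. Qed.

(** Above S4BP, a logic is non-tabular exactly when it omits every [Tab n]. This property passes to
    unions of chains, so Zorn applies. *)
Lemma pretabular_above L : tense_logic L -> S4BP_2omega_22 `<=` L ->
  ~ tabular L -> exists2 M, pretabular M & L `<=` M.
Proof.
move=> tL LS nL.
have [||M [[tM nM] LM Mmax]] :=
  @zorn_above _ [set M | tense_logic M /\ forall n, ~ M (Tab n)] L.
- by split=> // n /(Tab_tabular tL LS).
- move=> F F0 FQ Ftot; split.
    by apply: tense_logic_bigcup => // X /FQ[].
  by move=> n [X /FQ[_ nX] /nX].
exists M => //; split=> //.
  by move=> /tabular_Tab[n]; exact: nM.
move=> N tN [MN nNM] _; apply: contrapT => nN; apply: nNM; apply: Mmax => //.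
split=> // n /(Tab_tabular tN) tabN; apply/nN/tabN => f /LS/LM; exact: MN.
Qed.

Lemma pretabular_eq L K : pretabular L -> tense_logic K -> consistent K ->
  ~ tabular K -> L `<=` K -> L = K.
Proof.
move=> [tL nL Lmax] tK cK nK LK; apply/seteqP; split=> //.
by apply: contrapT => nKL; apply/nK/Lmax.
Qed.

(** * Blowing up one point of a frame to a finite cluster *)

Section Blow.
Variables (I : Type) (r : I -> I -> Prop) (v : I).

(** The points [inr a] are copies of [v]; at a reflexive [v] they add [n] points to its cluster. *)
Definition blow_proj n (w : I + 'I_n) : I := if w is inl i then i else v.

Definition blow n (w w' : I + 'I_n) : Prop := r (blow_proj w) (blow_proj w').

Definition blow_logic : set form := \bigcap_(n in [set: nat]) Log (@blow n).

Lemma tense_logic_blow : tense_logic blow_logic.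
Proof. by apply: tense_logic_bigcap => n _; exact: tense_logic_Log. Qed.

Lemma blow_consistent : consistent blow_logic.
Proof. by move=> /(_ 0 Logic.I)/(_ (fun _ => set0) (inl v)). Qed.

Lemma blow_not_tabular : r v v -> ~ tabular blow_logic.
Proof.
move=> rv /tabular_Tab[n] /(_ n.+2 Logic.I).
apply: (@notin_Log_Tab _ _ _ (inl v) (fun i => inr i)) => [i j []//|i].
have loop k : ball (@blow n.+2) k (inl v) (inl v).
  by elim: k => // k IH; exists (inl v) => //; left.
by exists (inl v) => //; left.
Qed.

End Blow.

(** * Logics of bounded z-degree *)

Section Cover.
Variables (T : eqType) (R : T -> T -> Prop).
Hypothesis frR : frame22 R.
Let rR := fr_refl frR.
Let tR := fr_trans frR.
Let dR := fr_depth frR.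

(** Among [a], [b] and a third point above [x], width two makes two adjacent, and depth two turns
    adjacency strictly above [x] into equality of clusters. A point below [x] is in the cluster of
    [x], since [a] is already strictly above. *)
Lemma up_cover x a b : R x a -> R x b -> ~ adj R a b ->
  forall y, adj R x y -> eqc R x y \/ eqc R a y \/ eqc R b y.
Proof.
have half u w : R x u -> R x w -> ~ adj R u w -> ~ R u x.
  by move=> xu xw uw ux; apply: uw; left; exact: tR xw.
move=> xa xb ab; have nax := half _ _ xa xb ab.
have nbx : ~ R b x by apply: half xb xa _ => ba; exact/ab/adjC.
have cmp c y : R x c -> ~ R c x -> R x y -> adj R c y -> eqc R x y \/ eqc R c y.
  move=> xc ncx xy [cy|yc]; last first.
    by case: (dR xy yc) => [yx|cy]; [left | right].
  by case: (dR xc cy) => [//|yc]; right.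
move=> y [xy|yx]; last first.
  by left; case: (dR yx xa).
have xs (i : 'I_3) : R x (nth a [:: a; b; y] i) by case: i => -[|[|[|]]].
have : [\/ adj R a b, adj R a y | adj R b y].
  have [[[|[|[|i]]] // ?] [[[|[|[|j]]] // ?] [//= _ yij]]] := fr_forth frR xs.
  - by constructor 1; left.
  - by constructor 2; left.
  - by constructor 1; right.
  - by constructor 3; left.
  - by constructor 2; right.
  - by constructor 3; right.
case=> [//|/(cmp _ _ xa nax xy)|/(cmp _ _ xb nbx xy)].
- by case; [left | right; left].
- by case; [left | right; right].
Qed.

Lemma up_list x : exists2 l : seq T, size l <= 3 &
  forall y, R x y -> exists2 z, z \in l & eqc R z y.
Proof.
have [[a [xa nax]]|none] := pselect (exists a, R x a /\ ~ eqc R x a); last first.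
  exists [:: x] => // y xy; exists x; first by rewrite inE.
  by apply: contrapT => h; apply: none; exists y.
have [[b [xb nbx nab]]|none] :=
    pselect (exists b, [/\ R x b, ~ eqc R x b & ~ eqc R a b]); last first.
  exists [:: x; a] => // y xy.
  have [xEy|nxy] := pselect (eqc R x y); first by exists x; rewrite ?inE ?eqxx.
  exists a; first by rewrite !inE eqxx orbT.
  by apply: contrapT => h; apply: none; exists y.
exists [:: x; a; b] => // y xy.
have nadj : ~ adj R a b.
  case=> [ab|ba].
    by case: (dR xa ab) => [ax|ba]; [apply: nax | apply: nab].
  by case: (dR xb ba) => [bx|ab]; [apply: nbx | apply: nab].
have xy' : adj R x y by left.
case: (up_cover xa xb nadj xy') => [?|[?|?]].
- by exists x; rewrite ?inE ?eqxx.
- by exists a; rewrite ?inE ?eqxx ?orbT.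
- by exists b; rewrite ?inE ?eqxx ?orbT.
Qed.

End Cover.

(** Three clusters upwards and, in the flipped frame, three downwards. *)
Lemma adj_list (T : eqType) (R : T -> T -> Prop) x : frame22 R ->
  exists2 l : seq T, size l <= 6 &
  forall y, adj R x y -> exists2 z, z \in l & eqc R z y.
Proof.
move=> frR; have [l1 s1 l1P] := up_list frR x.
have [l2 s2 l2P] := up_list (frame22_flip frR) x.
exists (l1 ++ l2); first by rewrite size_cat; exact: (leq_add s1 s2).
move=> y [/l1P|/l2P] [z zl zy]; exists z; rewrite ?mem_cat ?zl ?orbT //.
by case: zy.
Qed.

Lemma ball_list (T : eqType) (R : T -> T -> Prop) n x : frame22 R ->
  exists2 l : seq T, size l <= 6 ^ n &
  forall y, ball R n x y -> exists2 z, z \in l & eqc R z y.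
Proof.
move=> frR; have /choice[N NP] : forall x : T, exists l : seq T, size l <= 6 /\
    forall y, adj R x y -> exists2 z, z \in l & eqc R z y.
  by move=> y; have [l] := adj_list y frR; exists l.
elim: n => [|n [l sl lP]].
  exists [:: x] => // y <-; exists x; first by rewrite inE.
  exact: eqc_refl.
exists (flatten [seq N z | z <- l]).
  apply: (@leq_trans (size l * 6)); last by rewrite expnS mulnC leq_mul.
  elim: l {sl lP} => //= y l IH; rewrite size_cat mulSn leq_add //.
  exact: (NP y).1.
move=> y [u /lP[z zl zu] uy].
have [w wN wy] := (NP z).2 y (eqc_adj frR zu uy).
by exists w => //; apply/flatten_mapP; exists z.
Qed.

(** The axiom bounding the z-degree by [k]: balls stop growing at radius [k]. *)
Definition Zd (k : nat) : form :=
  Imp (iter k.+1 Zig (Var 0)) (iter k Zig (Var 0)).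

Lemma Zd_inst L k f : tense_logic L -> L (Zd k) ->
  L (Imp (iter k.+1 Zig f) (iter k Zig f)).
Proof.
move=> tL /(tl_subst tL (fun _ => f)).
by rewrite /Zd /= -/(Zig _) subst_zig.
Qed.

Section Skeleton.
Variables (L : set form) (T : choiceType) (R : T -> T -> Prop) (V : nat -> set T).
Hypotheses (tL : tense_logic L) (LS : S4BP_2omega_22 `<=` L).
Hypothesis rV : refined L R V.
Let frR : frame22 R := refined_frame22 tL LS rV.

(* [Box f], refuted along with [f] throughout the cluster of [y], or the
   negation of such a formula. *)
Lemma separate_clusters x y : ~ eqc R x y -> exists f,
  (forall z, eqc R x z -> sat R V z f) /\ (forall z, eqc R y z -> ~ sat R V z f).
Proof.
move=> /not_andP[nxy|nyx].
  have [f xf yf] := refined_tight rV nxy; exists (Box f); split.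
    by move=> z [xz _] u zu; apply: xf; exact: fr_trans xz zu.
  by move=> z [_ zy] /(_ y zy).
have [f yf xf] := refined_tight rV nyx; exists (Neg (Box f)); split.
  by move=> z [_ zx] /(_ x zx).
by move=> z [yz _]; apply=> u zu; apply: yf; exact: fr_trans yz zu.
Qed.

(** Finitely many clusters cover the ball. If [z] were outside, one formula would hold at [z] and
    fail on all of them, refuting an instance of [Zd k] at [x]. *)
Lemma Zd_ball_closed k x y z : 0 < k -> L (Zd k) ->
  ball R k x y -> adj R y z -> ball R k x z.
Proof.
move=> k0 Lk xy yz; apply: contrapT => nxz.
have [l _ lP] := ball_list k x frR.
(* The conjunction of the formulas separating [z] from each listed cluster other than its own. *)
have [f zf lf] : exists2 f, sat R V z f & forall u w, u \in l ->
    eqc R u w -> ~ eqc R u z -> ~ sat R V w f.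
  elim: l {lP} => [|a l [f zf lf]]; first by exists Top.
  have [az|naz] := pselect (eqc R z a).
    exists f => // u w; rewrite inE => /orP[/eqP -> _|]; last exact: lf.
    by case; exact: eqcC.
  have [g [gz ga]] := separate_clusters naz.
  exists (And f g); first by apply/sat_and; split=> //; exact: (gz _ (eqc_refl frR z)).
  move=> u w; rewrite inE => /orP[/eqP ->|ul] uw nuz /sat_and[fw gw].
    exact: ga gw.
  exact: lf ul uw nuz fw.
have : sat R V x (iter k.+1 Zig f) by apply/sat_zig; exists z => //; exists y.
have /sat_imp := refined_sound rV (Zd_inst f tL Lk) x; move=> /[apply].
move=> /sat_zig[w xw fw]; have [u ul uw] := lP w xw.
apply: (lf u w ul uw _ fw) => uz; apply: nxz.
apply: (ball_eqc frR k0 xw); apply: (eqc_trans frR _ uz); exact: eqcC.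
Qed.

Lemma skeleton k x : 0 < k -> L (Zd k) -> exists2 m, m <= 6 ^ k &
  exists c : 'I_m -> T, [/\ forall i j, eqc R (c i) (c j) -> i = j,
    forall i, ball R k x (c i) &
    forall y, ball R k x y -> exists i, eqc R (c i) y].
Proof.
move=> k0 Lk; have [l sl lP] := ball_list k x frR.
(* The value of [choose] depends only on the cluster, so removing duplicates leaves one
   representative per cluster. *)
pose rep y := choose (fun z => `[< eqc R y z >]) y.
have repE y : eqc R y (rep y).
  apply/asboolP; apply: (@chooseP _ (fun z => `[< eqc R y z >])).
  by apply/asboolP; exact: eqc_refl.
have rep_eq y z : eqc R y z -> rep y = rep z.
  move=> yz; rewrite /rep (_ : (fun u => `[< eqc R y u >]) =
      (fun u => `[< eqc R z u >])).
    by apply: choose_id; apply/asboolP => //; [exact: eqcC | exact: eqc_refl].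
  apply/funext => u; apply/asbool_equiv_eq; split=> [yu|zu].
    exact: (eqc_trans frR (eqcC yz) yu).
  exact: (eqc_trans frR yz zu).
pose s := undup [seq rep y | y <- l & `[< ball R k x y >]].
have sP i : i < size s -> exists2 y, ball R k x y & nth x s i = rep y.
  move=> /(mem_nth x); rewrite mem_undup => /mapP[y].
  by rewrite mem_filter => /andP[/asboolP xy _] ->; exists y.
exists (size s).
  apply: leq_trans sl; apply: leq_trans (size_undup _) _.
  by rewrite size_map size_filter count_size.
exists (fun i => nth x s i); split.
- move=> i j; have [y _ iy] := sP i (ltn_ord i); have [z _ jz] := sP j (ltn_ord j).
  move=> ij; apply/val_inj/eqP.
  rewrite -(nth_uniq x (ltn_ord i) (ltn_ord j) (undup_uniq _)) -/s iy jz.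
  apply/eqP/rep_eq; apply: (eqc_trans frR (repE y)); rewrite -iy.
  by apply: (eqc_trans frR ij); rewrite jz; apply: eqcC; exact: repE.
- move=> i; have [y xy ->] := sP i (ltn_ord i).
  exact: (ball_eqc frR k0 xy (repE y)).
move=> y xy; have [z zl zy] := lP y xy.
have xz : ball R k x z by apply: (ball_eqc frR k0 xy); exact: eqcC.
have zs : rep z \in s.
  by rewrite mem_undup; apply: map_f; rewrite mem_filter zl andbT; apply/asboolP.
have zs' : index (rep z) s < size s by rewrite index_mem.
exists (Ordinal zs'); rewrite /= nth_index //.
by apply: (eqc_trans frR _ zy); apply: eqcC; exact: repE.
Qed.

End Skeleton.

Lemma ball_stable (T : Type) (R : T -> T -> Prop) k x j y : frame22 R ->
  (forall y z, ball R k x y -> adj R y z -> ball R k x z) ->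
  ball R j x y -> ball R k x y.
Proof.
move=> frR closed; elim: j y => [|j IH] y; first by move=> <-; exact: ball_refl.
by move=> [z /IH]; exact: closed.
Qed.

(** In the marked cluster [n] points stay distinguished by formulas and the remaining ones are
    merged; every other cluster is merged to one point. The resulting classes are definable and
    closed under adjacency, so the collapse is a bisimulation. *)
Lemma refined_blow L (T : choiceType) (R : T -> T -> Prop) V k x m
    (c : 'I_m -> T) v n (z : 'I_n.+1 -> T) :
  tense_logic L -> S4BP_2omega_22 `<=` L -> refined L R V ->
  0 < k -> L (Zd k) ->
  (forall i j, eqc R (c i) (c j) -> i = j) -> (forall i, ball R k x (c i)) ->
  (forall y, ball R k x y -> exists i, eqc R (c i) y) ->
  injective z -> (forall a, eqc R (c v) (z a)) ->
  L `<=` Log (@blow _ (fun i j => R (c i) (c j)) v n).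
Proof.
move=> tL LS rV k0 Lk cI xc cX zI vz.
have frR := refined_frame22 tL LS rV; have tR := fr_trans frR.
have [s sP] : exists s, forall p a, sat R V (z a) (s p) <-> p = a :> nat.
  exact: definable_valuation_points rV zI (fun p => [set a | p = a :> nat]).
pose g (a : 'I_n.+1) :=
  And (Var a) (\big[And/Top]_(b < n.+1 | b != a) Neg (Var b)).
(* Only the first [n] of the [n.+1] given points get a formula. The last one keeps the class of
   [inl v] nonempty. *)
pose h (a : 'I_n) := subst s (g (lift ord_max a)).
have hP y a : sat R V y (h a) <-> sat R V y (s (lift ord_max a)) /\
    forall b : 'I_n.+1, b != lift ord_max a -> ~ sat R V y (s b).
  by rewrite sat_subst /g sat_and sat_bigand_ord.
have zh a b : sat R V (z b) (h a) <-> lift ord_max a = b.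
  rewrite hP sP; split=> [[/val_inj]//|<-]; split=> // d da.
  by rewrite sP => /val_inj E; rewrite E eqxx in da.
have h_excl y a b : sat R V y (h a) -> sat R V y (h b) -> a = b.
  move=> /hP[ha _] /hP[_ hb]; apply: contrapT => /eqP ab.
  by apply: (hb (lift ord_max a)) ha; rewrite (inj_eq (@lift_inj _ _)).
(* [A w] is the set of points collapsed to [w]. *)
pose A (w : 'I_m + 'I_n) : set T := match w with
  | inl i => [set y | eqc R (c i) y /\ (i = v -> forall a, ~ sat R V y (h a))]
  | inr a => [set y | eqc R (c v) y /\ sat R V y (h a)] end.
have Ac w y : A w y -> eqc R (c (blow_proj v w)) y by case: w => ? [].
have AX w y : A w y -> ball R k x y.
  by move=> /Ac wy; exact: (ball_eqc frR k0 (xc _) wy).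
have Aex w : exists y, A w y.
  case: w => [i|a]; last first.
    by exists (z (lift ord_max a)); split; [exact: vz | apply/zh].
  case: (pselect (i = v)) => [->|iv].
    exists (z ord_max); split; first exact: vz.
    by move=> _ a /zh /eqP; rewrite eq_sym (negbTE (neq_lift _ _)).
  by exists (c i); split=> //; exact: eqc_refl.
have Acov y : ball R k x y -> exists w, A w y.
  move=> /cX[i iy]; case: (pselect (exists2 a, i = v & sat R V y (h a))).
    by move=> [a iv ha]; exists (inr a); rewrite /A /= -iv.
  by move=> nh; exists (inl i); split=> // iv a ha; apply: nh; exists a.
have sepc w w' : blow_proj v w <> blow_proj v w' -> exists f,
    (forall y, A w y -> sat R V y f) /\ (forall y, A w' y -> ~ sat R V y f).
  move=> ww'; have [|f [f1 f2]] := @separate_clusters _ _ _ _ tL LS rV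
    (c (blow_proj v w)) (c (blow_proj v w')); first by move/cI.
  by exists f; split=> y /Ac; [exact: f1 | exact: f2].
have UP : forall U : nat -> set ('I_m + 'I_n)%type, exists s : nat -> form,
    forall p w y, A w y -> (sat R V y (s p) <-> U p w).
  apply: definable_valuation => w w' ww'.
  case: (pselect (blow_proj v w = blow_proj v w')) => [|/sepc//].
  case: w w' ww' => [i|a] [j|b] /= ww' E.
  - by rewrite E in ww'.
  - exists (Neg (h b)); split=> y /=; first by case=> _ /(_ E b).
    by case=> _ hb /(_ hb).
  - by exists (h a); split=> y; case=> // _ /(_ (esym E) a).
  - exists (h a); split=> y; case=> // _ hb ha; apply: ww'.
    by rewrite (h_excl _ _ _ ha hb).
move=> f Lf U w; have [y Awy] := Aex w.
have {UP} [q qP] := UP U.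
have := refined_subst q y tL rV Lf.
apply: (iffLR (@bisim_sat _ _ _ _ _ _ (fun _ y w => A w y) _ _ f _ _ _
  (leqnn _) Awy)); first by move=> _ y' w' p; exact: qP.
have adjA w1 y1 y2 : A w1 y1 -> adj R y1 y2 -> exists w2, A w2 y2.
  move=> /AX h1 h2; apply: Acov; exact: (Zd_ball_closed tL LS rV k0 Lk h1 h2).
have R_blow w1 y1 w2 y2 : A w1 y1 -> A w2 y2 ->
    R y1 y2 <-> blow (fun i j => R (c i) (c j)) v w1 w2.
  move=> /Ac[a1 b1] /Ac[a2 b2]; rewrite /blow.
  by split=> h12; [apply: tR a1 (tR _ _ _ h12 b2)|apply: tR b1 (tR _ _ _ h12 a2)].
move=> _ y1 w1 A1; split.
- move=> y2 R12; have [w2 A2] := adjA _ _ _ A1 (or_introl R12).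
  by exists w2 => //; apply/(R_blow _ _ _ _ A1 A2).
- by move=> w2 Q12; have [y2 A2] := Aex w2; exists y2 => //;
    apply/(R_blow _ _ _ _ A1 A2).
- move=> y2 R21; have [w2 A2] := adjA _ _ _ A1 (or_intror R21).
  by exists w2 => //; apply/(R_blow _ _ _ _ A2 A1).
- by move=> w2 Q21; have [y2 A2] := Aex w2; exists y2 => //;
    apply/(R_blow _ _ _ _ A2 A1).
Qed.

Lemma pigeonhole N m n (f : 'I_N.+1 -> 'I_m) : m * n <= N ->
  exists v, n < #|[pred a | f a == v]|.
Proof.
move=> mnN; apply: contrapT => small.
suff : N.+1 <= m * n by rewrite leqNgt ltnS mnN.
rewrite -{1}[N.+1]card_ord -sum1_card (partition_big f predT) //=.
have -> : m * n = \sum_(v < m) n by rewrite sum_nat_const card_ord.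
apply: leq_sum => v _.
rewrite sum1_card leqNgt; apply/negP => nv; apply: small; exists v.
by apply: leq_trans nv _; rewrite subset_leq_card //; apply/subsetP.
Qed.

(** If each [a] failed at some [b a], monotonicity would make all of them fail at the maximum of
    [b]. *)
Lemma finite_uniform (A : finType) (P : nat -> A -> Prop) :
  (forall n n' a, n <= n' -> P n' a -> P n a) ->
  (forall n, exists a, P n a) -> exists a, forall n, P n a.
Proof.
move=> Pmono Pex; apply: contrapT => none.
have /choice[b bP] : forall a, exists n, ~ P n a.
  by move=> a; apply/existsNP => Pa; apply: none; exists a.
have [a Pa] := Pex (\max_a b a).
by apply: (bP a); apply: Pmono Pa; exact: (leq_bigmax a).
Qed.

(** A frame on ['I_m] together with a marked vertex. *)
Definition code m : Type := ({ffun 'I_m * 'I_m -> bool} * 'I_m)%type.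
HB.instance Definition _ m :=
  Finite.copy (code m) ({ffun 'I_m * 'I_m -> bool} * 'I_m)%type.

Lemma bounded_zdegree L k : tense_logic L -> S4BP_2omega_22 `<=` L ->
  ~ tabular L -> 0 < k -> L (Zd k) -> 
  exists m (a : code m), code_rel a.1 a.2 a.2 /\
    L `<=` blow_logic (code_rel a.1) a.2.
Proof.
move=> tL LS nL k0 Lk; pose N := 6 ^ k.
(* Demanding all sizes up to [n] makes [P] monotone, as [finite_uniform] requires. Skeletons have at
   most [N] vertices, so there are finitely many candidates [b]. *)
pose P n (b : {m : 'I_N.+1 & code m}) := let: a := tagged b : code (tag b) in
  code_rel a.1 a.2 a.2 /\
  forall n', n' <= n -> L `<=` Log (@blow _ (code_rel a.1) a.2 n').
have [||[m [r v]] aP] := @finite_uniform _ P.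
- by move=> n n' a nn' [av aP]; split=> // n2 h; apply: aP; exact: leq_trans nn'.
(* Refuting [Tab M] gives [N * n + 1] points spread over at most [N] clusters, so some cluster
   contains more than [n] of them. *)
- move=> n; pose M := N * n.
  have : ~ L (Tab M) by move=> /(Tab_tabular tL LS).
  move=> /(refined_complete tL (LS _ S4BP_bw_back))[T [R [V [x [rV nx]]]]].
  have frR := refined_frame22 tL LS rV.
  have [e eI xe] := sat_Tab nx.
  have {xe} xe i : ball R k x (e i).
    by apply: ball_stable frR _ (xe i) => y z; exact: (Zd_ball_closed tL LS rV k0 Lk).
  have [m mN [c [cI xc cX]]] := skeleton tL LS rV x k0 Lk.
  have /choice[f fP] : forall i, exists j, eqc R (c j) (e i).
    by move=> i; exact: cX.
  have [|v nv] := @pigeonhole _ _ n f; first by rewrite leq_mul2r mN orbT.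
  pose r := [ffun ij => `[< R (c ij.1) (c ij.2) >]].
  exists (existT _ (Ordinal (mN : m < N.+1)) (r, v)); split=> /=.
    by rewrite /code_rel ffunE; apply/asboolP; exact: fr_refl.
  move=> n' n'n; have lev : n'.+1 <= #|[pred a | f a == v]|.
    exact: leq_ltn_trans nv.
  have := @refined_blow L T R V k x m c v n'
    (fun a => e (enum_val (widen_ord lev a))) tL LS rV k0 Lk cI xc cX.
  have -> : code_rel r = (fun i j => R (c i) (c j)).
    apply/funext => i; apply/funext => j; rewrite /code_rel ffunE propeqE.
    by split=> [/asboolP//|h]; apply/asboolP.
  apply.
    move=> a b /eI/enum_val_inj/(congr1 val) /= ab; exact: val_inj.
  move=> a; have := fP (enum_val (widen_ord lev a)).
  by have /eqP -> : f (enum_val (widen_ord lev a)) == v :=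
    enum_valP (widen_ord lev a).
exists m, (r, v); split; first exact: (aP 0).1.
by move=> f Lf n _; exact: (aP n).2 n (leqnn n) f Lf.
Qed.

(** * Logics of unbounded z-degree *)

Section Geodesic.
Variables (T : eqType) (R : T -> T -> Prop) (c : nat -> T) (K : nat).
Hypotheses (frR : frame22 R) (K2 : 1 < K).
Hypothesis cS : forall i, i < K -> adj R (c i) (c i.+1).
Hypothesis cN : forall i j, i.+1 < j -> j <= K -> ~ adj R (c i) (c j).

(** Otherwise a neighbouring step gives a chord between points two apart; [K2] supplies that
    step. *)
Lemma geodesic_neqc i : i < K -> ~ eqc R (c i) (c i.+1).
Proof.
case: i => [|i] iK ii.
  by apply: (@cN 0 2) => //; apply: (eqc_adj frR ii); exact: cS.
apply: (@cN i i.+2) => //; apply: (adj_eqc frR _ ii); apply: cS.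
exact: ltnW.
Qed.

(** Two consecutive steps in the same direction would compose to a chord. *)
Lemma geodesic_alternates i :
  i.+1 < K -> R (c i.+1) (c i.+2) <-> ~ R (c i) (c i.+1).
Proof.
move=> iK; split=> [h1 h0|h0].
  by apply: (@cN i i.+2) => //; left; exact: (fr_trans frR h0 h1).
have [//|h1] := cS iK; exfalso.
have [//|h2] := cS (ltnW iK).
by apply: (@cN i i.+2) => //; right; exact: (fr_trans frR h1 h2).
Qed.

(** The bit [b] records the direction of the first step, and alternation propagates it: the points
    with [odd i (+) b] are the lower ones. *)
Lemma geodesic_rel : exists b : bool, forall i j, i <= K -> j <= K ->
  R (c i) (c j) <-> i = j \/ (odd i (+) b /\ (j = i.+1 \/ i = j.+1)).
Proof.
have [b bP] : exists b : bool, forall i, i < K -> R (c i) (c i.+1) <-> odd i (+) b.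
  exists `[< R (c 0) (c 1) >]; elim=> [|i IH] iK.
    by split=> /asboolP.
  rewrite geodesic_alternates // (IH (ltnW iK)) /= addNb.
  by split=> [/negP|/negP].
exists b => i j iK jK; split=> [ij|[<-|[oi [ji|ij]]]].
- have [lt1|ge1] := ltnP i.+1 j; first by exfalso; apply: (cN lt1 jK); left.
  have [lt2|ge2] := ltnP j.+1 i; first by exfalso; apply: (cN lt2 iK); right.
  have [//|[ji|ij']] : i = j \/ (j = i.+1 \/ i = j.+1) by lia.
  + by left.
  + by right; split; [apply/bP; rewrite -?ji|left].
  + right; split; last by right.
    rewrite {1}ij' /= addNb; apply/negP => /bP; rewrite -ij' => /(_ iK) ji.
    by apply: (@geodesic_neqc j); rewrite -ij'.
- exact: fr_refl.
- by rewrite ji; apply/bP => //; rewrite -ji.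
- move: oi; rewrite ij /= addNb => /negP nj.
  have jK' : j < K by rewrite -ij.
  by have [/(bP _ jK')|//] := cS jK'.
Qed.

(** An inner point has two non-adjacent neighbours on the path, both above or both below it. By
    [up_cover], in the frame or its flip, no further cluster fits. *)
Lemma geodesic_cover i y : 0 < i -> i < K -> adj R (c i) y ->
  exists j, [/\ j <= K, i <= j.+1, j <= i.+1 & eqc R (c j) y].
Proof.
case: i => // i _ iK iy; have [b bP] := geodesic_rel.
have nadj : ~ adj R (c i) (c i.+2) by apply: cN.
have RP : forall k l, k <= K -> l <= K -> odd k (+) b ->
    l = k.+1 \/ k = l.+1 -> R (c k) (c l).
  by move=> k l kK lK ok kl; apply/bP => //; right.
suff [h|[h|h]] : eqc R (c i.+1) y \/ eqc R (c i) y \/ eqc R (c i.+2) y.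
- by exists i.+1; split=> //; lia.
- by exists i; split=> //; lia.
- by exists i.+2; split=> //; lia.
case ob : (odd i.+1 (+) b).
  by apply: (up_cover frR) => //; apply: RP; rewrite ?ob //; lia.
have nob : odd i (+) b by move: ob => /=; rewrite addNb => /negbFE.
have nadj' : ~ adj (fun x y => R y x) (c i) (c i.+2).
  by move=> [h|h]; apply: nadj; [right|left].
have iy' : adj (fun x y => R y x) (c i.+1) y.
  by case: iy; [right | left].
have := up_cover (frame22_flip frR) _ _ nadj' iy'.
have R1 : R (c i) (c i.+1) by apply: RP => //; lia.
have R2 : R (c i.+2) (c i.+1).
  by apply: RP; rewrite /= ?negbK //; lia.
case/(_ R1 R2) => [[h1 h2]|[[h1 h2]|[h1 h2]]].
- by left.
- by right; left.
- by right; right.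
Qed.

End Geodesic.

(** The two-sided infinite fence of single points. *)
Definition zigzag (a b : Z) : Prop :=
  a = b \/ (Z.odd a /\ (b = a + 1 \/ a = b + 1)%Z).

Lemma odd_of_nat n : Z.odd (Z.of_nat n) = odd n.
Proof. by elim: n => // n IH; rewrite Nat2Z.inj_succ Z.odd_succ -Z.negb_odd IH. Qed.

Lemma zigzag_not_tabular : ~ tabular (Log zigzag).
Proof.
move=> /tabular_Tab[n].
apply: (@notin_Log_Tab _ _ _ 0%Z (fun i => Z.of_nat i)) => [i j ij|i].
  by apply: val_inj => /=; lia.
suff H m k : k <= m -> ball zigzag m 0%Z (Z.of_nat k).
  by apply: H; rewrite -ltnS ltn_ord.
elim: m k => [|m IH] k; first by rewrite leqn0 => /eqP ->.
case: k => [_|k km].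
  by exists 0%Z; [exact: (IH 0) | left; left].
exists (Z.of_nat k); first exact: IH.
rewrite Nat2Z.inj_succ; case ok : (Z.odd (Z.of_nat k)); [left|right]; right.
  by split; [|left; lia].
by split; [rewrite Z.odd_succ -Z.negb_odd ok | right; lia].
Qed.

Lemma unbounded_zdegree L : tense_logic L -> S4BP_2omega_22 `<=` L ->
  (forall k, ~ L (Zd k.+1)) -> L `<=` Log zigzag.
Proof.
(* Evaluating [f] looks at most [D] steps away. A path of length [K] has room for this on both sides
   of a centre at [D] or [D.+1], with a spare step. *)
move=> tL LS nZ f Lf U z0; pose D := mdepth f; pose K := (D + D).+3.
have := nZ K.-2.
move=> /(refined_complete tL (LS _ S4BP_bw_back))[T [R [V [x [rV nx]]]]].
have frR := refined_frame22 tL LS rV.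
have [y xy nxy] : exists2 y, ball R K x y & ~ ball R K.-1 x y.
  apply: contrapT => h; apply: nx; rewrite /Zd; apply/sat_imp.
  move=> /sat_zig[y xy Vy]; apply/sat_zig; exists y => //.
  by apply: contrapT => nxy; apply: h; exists y.
have [c [c0 cK cS]] := ball_path xy.
(* A chord would shorten the path to at most [K.-1] steps. *)
have cN i j : i.+1 < j -> j <= K -> ~ adj R (c i) (c j).
  move=> ij jK cij; apply: nxy; rewrite -c0 -cK.
  apply: (@ball_le _ _ frR (i - 0 + 1 + (K - j))); first by lia.
  apply: (@ball_cat _ _ _ _ _ (c j)).
    apply: (@ball_cat _ _ _ _ _ (c i)); last exact: ball1.
    by apply: (path_ball cS); lia.
  by apply: (path_ball cS); lia.
have K2 : 1 < K by [].
have [b bP] := geodesic_rel frR K2 cS cN.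
(* One of two consecutive positions has the parity of [z0]; then the translation [h] sending [i0] to
   [z0] matches lower points with odd integers. *)
have [i0 i0D oi0] : exists2 i0, D <= i0 <= D.+1 & odd i0 (+) b = Z.odd z0.
  case: (eqVneq (odd D (+) b) (Z.odd z0)) => h; first by exists D => //; lia.
  by exists D.+1; [lia | rewrite /= addNb; case: (_ (+) b) h; case: (Z.odd z0)].
pose h (i : nat) := (z0 - Z.of_nat i0 + Z.of_nat i)%Z.
have hodd i : Z.odd (h i) = odd i (+) b.
  rewrite /h Z.odd_add Z.odd_sub !odd_of_nat -oi0.
  by case: (odd i0); case: b {bP oi0}; case: (odd i).
have hP i j : i <= K -> j <= K -> R (c i) (c j) <-> zigzag (h i) (h j).
  move=> iK jK; rewrite bP // /zigzag hodd /h.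
  split=> [[->|[oi ij]]|[ij|[oi ij]]]; [by left|right|left|right]; lia.
have neqc i j : i <= K -> j <= K -> i <> j -> ~ eqc R (c i) (c j).
  move=> iK jK ij [/bP-/(_ iK jK) [//|[oi h1]] /bP-/(_ jK iK) [/esym//|[oj _]]].
  case: h1 => E; move: oi oj; rewrite E /= addNb => h1 h2.
    by move: h2; rewrite h1.
  by move: h1; rewrite h2.
have [s sP] : exists s : nat -> form, forall p (i : 'I_K.+1) y,
    eqc R (c i) y -> (sat R V y (s p) <-> U p (h i)).
  apply: (@definable_valuation _ R V _ (fun (i : 'I_K.+1) y => eqc R (c i) y)
    _ (fun p i => U p (h i))) => i j ij.
  apply: (separate_clusters tL LS rV); apply: neqc; rewrite -1?ltnS ?ltn_ord //.
  by move=> /val_inj.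
(* With depth [d] left, the position keeps distance [d] from both ends, so before each further step
   it is an inner point of the path. *)
pose B d y w := exists i, [/\ d <= i, i + d <= K, eqc R (c i) y & w = h i].
have Bi0 : B D (c i0) z0.
  by exists i0; split; [lia | lia | exact: eqc_refl | rewrite /h; lia].
apply: (iffLR (@bisim_sat _ _ _ _ _ _ B _ _ f _ _ _ (leqnn _) Bi0));
  last exact: (refined_subst s (c i0) tL rV Lf).
  move=> d u w p [i [_ iK iu ->]]; have iK' : i < K.+1 by lia.
  exact: (sP p (Ordinal iK') u iu).
have cov d i u : d < i -> i + d < K -> adj R (c i) u -> exists j,
    [/\ j <= K, d <= j, j + d <= K & eqc R (c j) u].
  move=> di iK iu; have [||j [jK ij ji ju]] := geodesic_cover frR K2 cS cN _ _ iu.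
  - by lia.
  - by lia.
  by exists j; split=> //; lia.
have znear d i w : d < i -> i + d < K -> zigzag (h i) w \/ zigzag w (h i) ->
    exists j, [/\ j <= K, d <= j, j + d <= K & w = h j].
  move=> di iK iw; have [w1|[w1|w1]] :
    w = h i \/ (w = h i.+1 \/ w = h i.-1).
  + by case: iw => [[E|[_ E]]|[E|[_ E]]]; rewrite /h in E *; lia.
  + by exists i; split=> //; lia.
  + by exists i.+1; split=> //; lia.
  + by exists i.-1; split=> //; lia.
move=> d u w [i [di]]; rewrite addnS => iK iu ->.
have iK' : i <= K by lia.
split.
- move=> u' uu'; have [|j [jK dj jdK ju']] := cov d i u' di iK.
    by apply: (eqc_adj frR iu); left.
  exists (h j); last by exists j.
  apply/hP => //; apply: (fr_trans frR iu.1); exact: (fr_trans frR uu' ju'.2).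
- move=> w' iw; have [|j [jK dj jdK E]] := znear d i w' di iK; first by left.
  exists (c j); last by exists j; split=> //; exact: eqc_refl.
  by apply: (fr_trans frR iu.2); apply/hP => //; rewrite -E.
- move=> u' uu'; have [|j [jK dj jdK ju']] := cov d i u' di iK.
    by apply: (eqc_adj frR iu); right.
  exists (h j); last by exists j.
  apply/hP => //; apply: (fr_trans frR ju'.1); exact: (fr_trans frR uu' iu.2).
- move=> w' iw; have [|j [jK dj jdK E]] := znear d i w' di iK; first by right.
  exists (c j); last by exists j; split=> //; exact: eqc_refl.
  by apply: (fun H => fr_trans frR H iu.1); apply/hP => //; rewrite -E.
Qed.

(** * Infinitely many pretabular logics *)

Definition path_rel (i j : nat) : Prop :=
  i = j \/ (odd i /\ (j = i.+1 \/ i = j.+1)).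

Lemma path_adj i j : i <= j.+1 -> j <= i.+1 -> adj path_rel i j.
Proof.
move=> ij ji; have [->|[->|->]] : i = j \/ (j = i.+1 \/ i = j.+1) by lia.
- by left; left.
- by case oi : (odd i); [left | right]; right; rewrite /= ?oi; split=> //; lia.
- by case oj : (odd j); [right | left]; right; rewrite /= ?oj; split=> //; lia.
Qed.

(** A vertex has at most two neighbours: of three points related to it, one is the vertex itself or
    two coincide. *)
Lemma path_frame22 : frame22 path_rel.
Proof.
pose o0 := @Ordinal 3 0 isT; pose o1 := @Ordinal 3 1 isT; pose o2 := @Ordinal 3 2 isT.
have three (y : 'I_3 -> nat) :
    path_rel (y o0) (y o1) \/ path_rel (y o1) (y o0) \/ path_rel (y o0) (y o2)
    \/ path_rel (y o2) (y o0) \/ path_rel (y o1) (y o2) \/ path_rel (y o2) (y o1) ->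
    exists i j, i != j /\ path_rel (y i) (y j).
  by move=> [h|[h|[h|[h|[h|h]]]]]; do 2 eexists; (split; last exact: h).
have same (y : 'I_3 -> nat) :
    [\/ y o0 = y o1, y o0 = y o2 | y o1 = y o2] ->
    path_rel (y o0) (y o1) \/ path_rel (y o1) (y o0) \/ path_rel (y o0) (y o2)
    \/ path_rel (y o2) (y o0) \/ path_rel (y o1) (y o2) \/ path_rel (y o2) (y o1).
  by case=> ->; [left | do 2 right; left | do 4 right; left]; left.
have two x a b c : (a = x.+1 \/ x = a.+1) -> (b = x.+1 \/ x = b.+1) ->
    (c = x.+1 \/ x = c.+1) -> [\/ a = b, a = c | b = c].
  move=> ha hb hc; have [h|[h|h]] : a = b \/ a = c \/ b = c by lia.
  - by constructor 1.
  - by constructor 2.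
  - by constructor 3.
split.
- by left.
- by rewrite /path_rel => x y z; lia.
- by rewrite /path_rel => x y z; lia.
- move=> x y xy; apply: three.
  have [E|n0] := eqVneq (y o0) x; first by left; rewrite E.
  have [E|n1] := eqVneq (y o1) x; first by right; left; rewrite E.
  have [E|n2] := eqVneq (y o2) x; first by do 3 right; left; rewrite E.
  have near i : y i != x -> y i = x.+1 \/ x = (y i).+1.
    by case: (xy i) => [->|[_ //]]; rewrite eqxx.
  exact: (same y (two x _ _ _ (near _ n0) (near _ n1) (near _ n2))).
- move=> x y xy; apply: three.
  have [E|n0] := eqVneq (y o0) x; first by right; left; rewrite E.
  have [E|n1] := eqVneq (y o1) x; first by left; rewrite E.
  have [E|n2] := eqVneq (y o2) x; first by do 2 right; left; rewrite E.
  have near i : y i != x -> y i = x.+1 \/ x = (y i).+1.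
    by case: (xy i) => [->|[_ [] ?]]; rewrite ?eqxx //; [right | left].
  exact: (same y (two x _ _ _ (near _ n0) (near _ n1) (near _ n2))).
Qed.

Definition finite_path_rel n (i j : 'I_n.+1) : Prop :=
  path_rel (val i) (val j).

Definition path_logic (n : nat) : set form :=
  blow_logic (@finite_path_rel n) ord0.

Definition mixed (f : form) : form :=
  And (And (Dia f) (Dia (Neg f))) (And (Past f) (Past (Neg f))).

(* Since [mixed f] holds in any cluster split by [f], this forces a point at
   zigzag distance [n.+1] from each cluster with two points. *)
Definition far (n : nat) : form :=
  Imp (mixed (Var 0)) (iter n.+1 Zig (Neg (iter n Zig (mixed (Var 0))))).

Section PathFrame.
Variables n m : nat.
Let Q := @blow _ (@finite_path_rel n) ord0 m.
Let pos (w : 'I_n.+1 + 'I_m) : nat := blow_proj ord0 w.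

Lemma path_blow_dist d w w' : ball Q d w w' ->
  pos w <= pos w' + d /\ pos w' <= pos w + d.
Proof.
elim: d w' => [|d IH] w'; first by move=> ->; lia.
move=> [u /IH wu uw']; have : path_rel (pos u) (pos w') \/ path_rel (pos w') (pos u).
  exact: uw'.
by rewrite /path_rel; lia.
Qed.

(** The radius is positive because distinct copies of vertex 0 share a position. *)
Lemma path_blow_ball d w w' :
  pos w <= pos w' + d.+1 -> pos w' <= pos w + d.+1 -> ball Q d.+1 w w'.
Proof.
have posK i (ilt : i < n.+1) : pos (inl (Ordinal ilt)) = i by [].
have pn u : pos u < n.+1 by exact: ltn_ord.
have Qadj u u' : pos u <= (pos u').+1 -> pos u' <= (pos u).+1 -> adj Q u u'.
  exact: path_adj.
elim: d w' => [|d IH] w' h1 h2.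
  by exists w => //; apply: Qadj; lia.
have [k [kn k1 k2 k3 k4]] : exists k, [/\ k < n.+1, pos w <= k + d.+1,
    k <= pos w + d.+1, k <= (pos w').+1 & pos w' <= k.+1].
  have := pn w; have := pn w'; have [lt|lt|eq] := ltngtP (pos w) (pos w').
  - by exists (pos w').-1; split; lia.
  - by exists (pos w').+1; split; lia.
  - by exists (pos w'); split; lia.
exists (inl (Ordinal kn)); first exact: IH.
exact: Qadj.
Qed.

Lemma Log_path_Zd : 0 < n -> Log Q (Zd n).
Proof.
move=> n0 V x; apply/sat_imp => /sat_zig[y _ Vy]; apply/sat_zig; exists y => //.
have pn u : pos u < n.+1 by exact: ltn_ord.
suff : ball Q n.-1.+1 x y by rewrite [X in ball _ X](prednK n0).
by apply: path_blow_ball; have := pn x; have := pn y; lia.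
Qed.

(** Nothing lies strictly below an odd position or strictly above an even one. In that direction
    [mixed f] splits the cluster itself, and only the cluster at position 0 can have two points. *)
Lemma path_mixed V f x : sat Q V x (mixed f) -> pos x = 0.
Proof.
move=> /sat_and[/sat_and[/sat_dia[y1 xy1 fy1] /sat_dia[y2 xy2 fy2]]].
move=> /sat_and[/sat_past[z1 zx1 fz1] /sat_past[z2 zx2 fz2]].
apply: contrapT => x0.
have one y z : sat Q V y f -> sat Q V z (Neg f) -> pos y = pos x ->
    pos z = pos x -> False.
  move=> fy nfz yx zx; apply: nfz; suff -> : z = y by [].
  move: x0; rewrite -{1}yx; move: yx zx => <-.
  case: y {fy} => [i|?]; case: z => [j|?] //=; rewrite /pos /=.
    by move=> /val_inj ->.
  by move=> <-.
have QP u u' : Q u u' -> path_rel (pos u) (pos u') by [].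
have : (pos y1 = pos x /\ pos y2 = pos x) \/ (pos z1 = pos x /\ pos z2 = pos x).
  case ox : (odd (pos x)); [right | left].
    have h z : Q z x -> pos z = pos x.
      by move=> /QP[//|[oz [E|E]]]; [move: ox | move: oz]; rewrite E /= ?oz ?ox.
    by split; exact: h.
  have h y : Q x y -> pos y = pos x by move=> /QP[//|[]]; rewrite ox.
  by split; exact: h.
by case=> -[]; exact: one.
Qed.

End PathFrame.

Lemma path_logic_Zd n : 0 < n -> path_logic n (Zd n).
Proof. by move=> n0 m _; exact: Log_path_Zd. Qed.

(** The witness is the other end of the path: position [n.+1] is reached from 0 in [n.+1] steps, but
    not in [n], and [mixed] can hold only at position 0. *)
Lemma path_logic_far n : path_logic n.+1 (far n).
Proof.
move=> m _ V x; apply/sat_imp => /path_mixed x0; apply/sat_zig.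
exists (inl ord_max); first by apply: path_blow_ball; rewrite x0 /=; lia.
apply/sat_neg => /sat_zig[u ud /path_mixed u0].
by have := path_blow_dist ud; rewrite u0 /=; lia.
Qed.

Lemma path_logic_S4BP n : S4BP_2omega_22 `<=` path_logic n.
Proof.
move=> f Sf m _; apply: (S4BP_frame22 _ Sf).
by apply: frame22_preim; apply: frame22_preim; exact: path_frame22.
Qed.

(** A formula splitting a cluster makes [mixed f] true in it; [far n] then gives a point within
    [n.+1] steps but not within [n], which [Zd n] forbids. *)
Lemma far_trivial_clusters L (T : choiceType) (R : T -> T -> Prop) V n x y :
  tense_logic L -> S4BP_2omega_22 `<=` L -> refined L R V ->
  L (far n) -> L (Zd n) -> eqc R x y -> x = y.
Proof.
move=> tL LS rV Lf LZ [xy yx]; have frR := refined_frame22 tL LS rV.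
apply: contrapT => /(refined_diff rV)[f fx fy].
have := refined_sound rV (tl_subst tL (fun _ => f) Lf) x.
have -> : subst (fun _ => f) (far n) =
    Imp (mixed f) (iter n.+1 Zig (Neg (iter n Zig (mixed f)))).
  by rewrite /far /= !subst_zig /= subst_zig.
have mx : sat R V x (mixed f).
  have rx := fr_refl frR x.
  do 2 (apply/sat_and; split); try apply/sat_dia; try apply/sat_past;
    by [exists x | exists y].
move=> /sat_imp/(_ mx)/sat_zig[u xu]; apply.
have := refined_sound rV (Zd_inst (mixed f) tL LZ) u; move/sat_imp; apply.
by apply/sat_zig; exists x => //; exact: ballC.
Qed.

(** Clusters are single points, so a component has no more points than its skeleton has vertices. *)
Lemma far_Zd_tabular L n : tense_logic L -> S4BP_2omega_22 `<=` L ->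
  L (far n.+1) -> L (Zd n.+1) -> tabular L.
Proof.
move=> tL LS Lf LZ; pose N := 6 ^ n.+1.
apply: (@Tab_tabular L N) => //; apply: contrapT.
move=> /(refined_complete tL (LS _ S4BP_bw_back))[T [R [V [x [rV nx]]]]].
have frR := refined_frame22 tL LS rV.
have [e eI xe] := sat_Tab nx.
have {}xe i : ball R n.+1 x (e i).
  by apply: ball_stable frR _ (xe i) => y z; exact: (Zd_ball_closed tL LS rV (ltn0Sn n) LZ).
have [m mN [c [cI xc cX]]] := skeleton tL LS rV x (ltn0Sn n) LZ.
have /choice[f fP] : forall i, exists j, eqc R (c j) (e i).
  by move=> i; exact: cX.
have fI : injective f.
  move=> i j fij; apply: eI; apply: (far_trivial_clusters tL LS rV Lf LZ).
  by apply: (eqc_trans frR (eqcC (fP i))); rewrite fij.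
have := leq_card f fI; rewrite !card_ord leqNgt ltnS.
by rewrite mN.
Qed.

Lemma Zd_le L j k : tense_logic L -> j <= k -> L (Zd j) -> L (Zd k).
Proof.
move=> tL jk Lj; rewrite -(subnKC jk); elim: (k - j) => [|d IH].
  by rewrite addn0.
have := Zd_inst (Zig (Var 0)) tL IH; rewrite -!iterSr addnS.
by [].
Qed.

Lemma PTAB_infinite : ~ finite_set (PTAB S4BP_2omega_22).
Proof.
have /choice[M MP] : forall k, exists M,
    [/\ PTAB S4BP_2omega_22 M, M (Zd k.+2) & ~ M (Zd k.+1)].
  (* This logic contains [Zd k.+2] and [far k.+1]. Adding [Zd k.+1] to the latter would force
     tabularity, so the bound [k.+2] is sharp for [M]. *)
  move=> k; have SP := @path_logic_S4BP k.+2.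
  have [||M pM PM] := @pretabular_above (path_logic k.+2) _ SP.
  - exact: tense_logic_blow.
  - by apply: blow_not_tabular; left.
  have SM : S4BP_2omega_22 `<=` M by move=> f /SP/PM.
  have [tM nM _] := pM; exists M; split=> //.
    by apply: PM; exact: path_logic_Zd.
  by move=> MZ; apply/nM/(far_Zd_tabular tM SM _ MZ)/PM/path_logic_far.
have tM k : tense_logic (M k) by have [[[]]] := MP k.
(* [M j] contains [Zd j.+2], hence [Zd k.+1] because [j.+2 <= k.+1], while [M k] omits it. *)
have Mlt j k : j < k -> M j <> M k.
  move=> jk E; have [_ h _] := MP j; have [_ _] := MP k; apply.
  by apply: Zd_le (tM k) _ _; [|rewrite -E; exact: h].
have MI : injective M.
  move=> j k E; have [/Mlt/(_ E)//|/Mlt/(_ (esym E))//|//] := ltngtP j k.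
move=> fin; apply: infinite_nat.
rewrite -(eq_finite_set (@inj_card_eq _ _ [set: nat] M _)); last first.
  by move=> j k _ _; exact: MI.
by apply: sub_finite_set fin => _ [k _ <-]; have [] := MP k.
Qed.

(** * Countability and the cardinality of the set of pretabular logics *)

Lemma PTAB_countable : countable (PTAB S4BP_2omega_22).
Proof.
(* The candidates: the infinite zigzag for unbounded z-degree, and the blow-ups of finite marked
   skeletons otherwise. Each lies above a given pretabular logic only by equality, being consistent
   and, at a reflexive marked vertex, non-tabular. *)
pose F (o : option {m : nat & code m}) : set form :=
  if o is Some a then blow_logic (code_rel (tagged a).1) (tagged a).2
  else Log zigzag.
apply: (@sub_countable _ _ _ (F @` setT)); last first.
  exact: sub_countable (card_image_le _ _) (countableP _).
apply: subset_card_le => L [pL SL]; have [tL nL _] := pL.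
have [[k Lk]|nZ] := pselect (exists k, L (Zd k.+1)).
  have [m [a [av La]]] := bounded_zdegree tL SL nL (ltn0Sn k) Lk.
  exists (Some (existT _ m a)) => //; apply/esym/pretabular_eq => //.
  - exact: tense_logic_blow.
  - exact: blow_consistent.
  - exact: blow_not_tabular.
exists None => //; apply/esym/pretabular_eq => //.
- exact: tense_logic_Log.
- by move=> /(_ (fun _ => set0) 0%Z).
- exact: zigzag_not_tabular.
by apply: unbounded_zdegree => // k Lk; apply: nZ; exists k.
Qed.

Theorem theorem7p13 : PTAB S4BP_2omega_22 #= [set: nat].
Proof. exact: eq_card_nat PTAB_countable PTAB_infinite. Qed.
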